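(* Fix $\ell\in\mathbb{N}$ and a constant $\kappa>0$ independent of $N$. For each $N$ let $H_N^{(1)},\dots,H_N^{(\ell)}$ be random $N\times N$ real symmetric matrices on the same probability space (with arbitrary dependence between them). Assume that for each $i\in\{1,\dots,\ell\}$: (W) There is a sequence of probability measures $(\mu_N^{(i)})_N$ on $\mathbb{R}$ such that ${\rm W}_1(\mathbb{E}\hat\mu_{H_N^{(i)}},\mu_N^{(i)})\le N^{-\kappa}$; these measures are supported in a common compact set; and each has a density $\mu^{(i)}_N(\cdot)$ in $(-\kappa,\kappa)$ satisfying $\mu_N^{(i)}(x)<\kappa^{-1}|x|^{-1+\kappa}$ for all $|x|<\kappa$ and all $N$. (L) There exists $\epsilon_0>0$ such that for every $\zeta>0$ there exists $c_\zeta>0$ such that, whenever $f:\mathbb{R}\to\mathbb{R}$ is Lipschitz, for every $\delta>0$, $$\mathbb{P}\left(\left|\frac1N\mathrm{Tr}(f(H_N^{(i)}))-\frac1N\mathbb{E}[\mathrm{Tr}(f(H_N^{(i)}))]\right|>\delta\right)\le\exp\left(-\frac{c_\zeta}{N^\zeta}\min\left\{\left(\frac{N\delta}{\|f\|_{\mathrm{Lip}}}\right)^2,\left(\frac{N\delta}{\|f\|_{\mathrm{Lip}}}\right)^{1+\epsilon_0}\right\}\right).$$ (Gap) For every $\epsilon>0$, $\lim_{N\to\infty}\mathbb{P}(H_N^{(i)}\text{ has no eigenvalues in }[-e^{-N^\epsilon},e^{-N^\epsilon}])=1$. Then $$\lim_{N\to\infty}\left(\frac1N\log\mathbb{E}\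Big[\prod_{i=1}^\ell|\det(H_N^{(i)})|\Big]-\sum_{i=1}^\ell\int_{\mathbb{R}}\log|\lambda|\,\mu_N^{(i)}(d\lambda)\right)=0.$$
   Context: $\hat\mu_T=\frac1N\sum_{j=1}^N\delta_{\lambda_j(T)}$ is the empirical spectral measure of a symmetric $N\times N$ matrix $T$; $\mathbb{E}\hat\mu_T$ is the averaged measure. $\|f\|_{\mathrm{Lip}}$ is the Lipschitz constant. ${\rm W}_1(\mu,\nu)=\sup\{|\int f\,d(\mu-\nu)|:\|f\|_{\mathrm{Lip}}\le1\}$. *)

(* Defs.v *)
From HB Require Import structures.
From mathcomp Require Import all_boot all_order all_algebra.
From mathcomp Require Import complex.
From mathcomp Require Import all_classical all_reals all_analysis.

Set Implicit Arguments.
Unset Strict Implicit.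
Unset Printing Implicit Defensive.

Import Order.TTheory GRing.Theory Num.Theory.
Import numFieldNormedType.Exports.

Local Open Scope classical_set_scope.
Local Open Scope ring_scope.

Section Spectrum.
Context {R : realType} {N : nat}.
Implicit Types (T : 'M[R]_N) (f : R -> R).

(* The library diagonalizes normal matrices over a numClosedFieldType, so a
   real symmetric T is diagonalized over R[i], where its eigenvalues are real:
   T = P^-1 diag(lambda_0, ..., lambda_(N-1)) P with P unitary. *)
Definition toC T : 'M[R[i]]_N := map_mx (real_complex R) T.

(* The eigenvalues of a symmetric T with multiplicity, in the (unspecified)
   order of [spectral_diag]; nothing below depends on that order. *)
Definition eigval T (j : 'I_N) : R := complex.Re (spectral_diag (toC T) 0 j).

(* f(T) = P^-1 diag(f(lambda_0), ..., f(lambda_(N-1))) P; this matrix has real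
   entries, and taking real parts only changes its type. *)
Definition fun_mx f T : 'M[R]_N :=
  let P := spectralmx (toC T) in
  map_mx (@complex.Re R)
    (invmx P *m diag_mx (\row_j real_complex R (f (eigval T j))) *m P).

Lemma symmetric_toC T : T \is symmetricmx ->
  toC T = invmx (spectralmx (toC T))
    *m diag_mx (\row_j real_complex R (eigval T j)) *m spectralmx (toC T).
Proof.
move=> /is_hermitianmxP; rewrite expr0 scale1r => symT.
have hermT : toC T \is hermsymmx.
  apply/is_hermitianmxP; rewrite expr0 scale1r.
  apply/matrixP => i j; rewrite !mxE; move/matrixP: symT => /(_ i j).
  rewrite !mxE /= => ->; exact: esym (conjc_real _).
have /orthomx_spectralP eqT := hermitian_normalmx hermT.
rewrite [LHS]eqT; congr (_ *m diag_mx _ *m _).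
apply/rowP => j; rewrite !mxE /eigval.
have /mxOverP /(_ 0 j) := hermitian_spectral_diag_real hermT.
by move=> /complex_realP[x ->].
Qed.

Lemma char_poly_eigval T : T \is symmetricmx ->
  char_poly T = \prod_(j < N) ('X - (eigval T j)%:P).
Proof.
move=> /symmetric_toC; set P := spectralmx _; set D := diag_mx _ => eqT.
have uP : P \in unitmx by exact: spectral_unit.
apply: (map_poly_inj (real_complex R)); rewrite map_char_poly -/(toC T) eqT.
have -> : char_poly (invmx P *m D *m P) = char_poly D.
  have eqX : ('X%:M : 'M[{poly R[i]}]_N)
      = map_mx polyC (invmx P) *m 'X%:M *m map_mx polyC P.
    by rewrite scalar_mxC -mulmxA -map_mxM mulVmx// map_mx1 mulmx1.
  rewrite /char_poly /char_poly_mx [in LHS]eqX !map_mxM -mulmxBl -mulmxBr.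
  by rewrite !det_mulmx mulrAC -det_mulmx -map_mxM mulVmx// map_mx1 det1 mul1r.
rewrite char_poly_trig ?diag_mx_is_trig// rmorph_prod.
apply: eq_bigr => j _.
by rewrite rmorphB /= map_polyX map_polyC /D !mxE eqxx mulr1n.
Qed.

Lemma mxtrace_fun_mx f T : \tr (fun_mx f T) = \sum_(j < N) f (eigval T j).
Proof.
rewrite /fun_mx; set P := spectralmx _; set D := diag_mx _.
have ReD : {morph @complex.Re R : x y / x + y} by case=> a b [].
transitivity (complex.Re (\tr (invmx P *m D *m P))).
  rewrite /mxtrace (big_morph _ ReD (erefl _)).
  by apply: eq_bigr => j _; rewrite mxE.
rewrite mxtrace_mulC mulmxA mulmxV ?spectral_unit// mul1mx mxtrace_diag.
rewrite (big_morph _ ReD (erefl _)).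
by apply: eq_bigr => j _; rewrite mxE.
Qed.

End Spectrum.

Section SpectralMeasure.
Context {R : realType}.
Local Open Scope ereal_scope.

Definition emp_spec N (T : 'M[R]_N) : set R -> \bar R :=
  fun A => (N%:R^-1)%:E * \sum_(j < N) \d_(eigval T j) A.

Definition avg_emp_spec d (Omega : measurableType d) (P : probability Omega R)
    N (H : Omega -> 'M[R]_N) : set R -> \bar R :=
  fun A => \int[P]_w emp_spec (H w) A.

(* The Lipschitz constant, +oo if f is not Lipschitz. *)
Definition lip_norm (f : R -> R) : \bar R :=
  ereal_sup [set (`|f xy.1 - f xy.2| / `|xy.1 - xy.2|)%:E
            | xy in [set xy : R * R | xy.1 != xy.2]].

(* When one of the measures has no first moment, some f makes the difference of
   integrals infinite (with +oo - +oo = -oo), so that the distance is +oo. *)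
Definition W1 (mu nu : set R -> \bar R) : \bar R :=
  ereal_sup [set `| \int[mu]_x (f x)%:E - \int[nu]_x (f x)%:E |
            | f in [set f : R -> R | lip_norm f <= 1]].

End SpectralMeasure.

Section Assumptions.
Context {R : realType}.

Definition random_symmx d (Omega : measurableType d) N
    (H : Omega -> 'M[R]_N) : Prop :=
  (forall j k, measurable_fun [set: Omega] (fun w => H w j k)) /\
  (forall w, H w \is symmetricmx).

(* The bound on the density is asked for x != 0 only: at 0 its right-hand side
   means +oo when kappa < 1, whereas 0 `^ (-1 + kappa) = 0 by convention; and a
   density may be changed at one point anyway. *)
Definition has_density_near0 (kappa : R) (nu : set R -> \bar R) : Prop :=
  exists rho : R -> R,
    [/\ measurable_fun `](- kappa), kappa[ rho,
        forall x, `|x| < kappa -> 0 <= rho x,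
        forall A : set R, measurable A -> A `<=` `](- kappa), kappa[ ->
          nu A = (\int[lebesgue_measure]_(x in A) (rho x)%:E)%E &
        forall x, 0 < `|x| < kappa ->
          rho x < kappa^-1 * `|x| `^ (-1 + kappa)].

Context {d : nat -> measure_display} {Omega : forall N, measurableType (d N)}.
Variables (P : forall N, probability (Omega N) R).
Variables (H : forall N, Omega N -> 'M[R]_N).

(* All three assumptions range over N >= 1: there is no empirical spectral
   measure for N = 0. *)

Definition assumption_W (kappa : R)
    (mu : nat -> probability R R) : Prop :=
  [/\ forall N, (0 < N)%N ->
        (W1 (avg_emp_spec (P N) (@H N)) (mu N) <= (N%:R `^ (- kappa))%:E)%E,
      exists2 K : set R, compact K &
        forall N, (0 < N)%N -> mu N (~` K) = 0%E &
      forall N, (0 < N)%N -> has_density_near0 kappa (mu N)].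

(* If lip_norm f = 0 then f is constant and the event is empty; division by 0
   turns the bound into the trivial expR 0 = 1, so nothing is lost. *)
Definition assumption_L : Prop :=
  exists2 eps0 : R, 0 < eps0 &
  forall zeta : R, 0 < zeta -> exists2 c : R, 0 < c &
  forall f : R -> R, [lipschitz f x | x in [set: R]] ->
  forall delta : R, 0 < delta -> forall N : nat, (0 < N)%N ->
    let x := N%:R * delta / fine (lip_norm f) in
    (P N [set w | delta%:E <
          `| (N%:R^-1 * \tr (fun_mx f (H w)))%:E
             - (N%:R^-1)%:E * 'E_(P N)[fun w' => \tr (fun_mx f (H w'))] |]
     <= (expR (- (c / N%:R `^ zeta)
               * Num.min (x ^+ 2) (x `^ (1 + eps0))))%:E)%E.

Definition assumption_Gap : Prop :=
  forall eps : R, 0 < eps ->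
  let r N := expR (- (N%:R `^ eps)) in
  P N [set w | forall x, eigenvalue (H w) x -> x \notin `[- r N, r N]]
    @[N --> \oo] --> 1%E.

End Assumptions.

(* Main.v *)
Require Import Defs.
From HB Require Import structures.
From mathcomp Require Import all_boot all_order all_algebra complex.
From mathcomp Require Import all_classical all_reals all_analysis.
From mathcomp Require Import measurable_realfun giry.
From mathcomp Require Import ring lra.

Set Implicit Arguments.
Unset Strict Implicit.
Unset Printing Implicit Defensive.

Import Order.TTheory GRing.Theory Num.Theory.
Import numFieldNormedType.Exports.
Local Open Scope classical_set_scope.
Local Open Scope ring_scope.

(** Since [ln `|\det (H w)|] is the trace of [ln |.|] of the matrix [H w], and the
    logarithm is singular at 0 only, it can be enclosed between traces of
    Lipschitz functions. [assumption_W] moves the mean of such a trace onto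
    [mu N] ([W1_klipschitz]) and [assumption_L] controls its fluctuations
    ([lipschitz_tail]).

    Upper bound ([det_upper]). The majorant is [logmax eta], that is
    [ln (max(|x|, eta))], for a fixed [eta]. A deviation of its trace by more
    than [u] has probability at most [exp (- (l + 1) u)] as soon as
    [u >= delta N] and [N] is large, because the concentration rate is
    superlinear in [u] ([tail_rate]). Hence the exponential moment of order [l]
    of the deviation is [exp (o(N))] ([exp_moment_le], [mean_dev_moment]). The
    order [l] allows for an arbitrary dependence between the [l] matrices,
    through [exp (x_1 + ... + x_l) <= 1 + exp (l x_1) + ... + exp (l x_l)]
    ([expR_sum_le], [integral_prod_le]). Replacing [logmax eta] by [ln |.|] costs
    [O(eta ^ kappa)] ([integral_logmax]), which is as small as desired.

    Lower bound ([det_lower]). The minorant is [logmax b - A * tent b] where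
    [b = N ^ (- beta)], [A = N ^ a] and [tent b] dominates the indicator of
    [[- b, b]]. It is below [ln |x|] when [|x| > exp (- A)]
    ([logmax_tent_le_ln]), hence at every eigenvalue with high probability, by
    [assumption_Gap]. Its Lipschitz constant is of order [N ^ (a + beta)] and
    [mu N] gives to [[- 2 b, 2 b]] a mass of order [b ^ kappa]
    ([density_sym_itv]), so all the errors vanish when [a < beta * kappa] and
    [a + beta < min(kappa, 1)]. The good events of the [l] matrices occur
    together with probability at least one half, and the factor one half is
    negligible at the exponential scale ([integral_prod_ge]).

    All this requires traces of functions of a random matrix to be measurable,
    although its eigenvalues come in an unspecified order. The trace of a
    rational function of a matrix is a rational function of its entries, and
    limits of such traces count the eigenvalues in a ray
    ([measurable_count_ray]). So the empirical spectral measure is a measurable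
    map to the space of subprobability measures ([measurable_random_spec]), and
    [avg_emp_spec] is its average in the sense of the Giry monad
    ([avg_emp_specE]). *)

(** * Functional calculus of symmetric matrices *)

Section SpectralCalculus.
Context {R : realType} {N : nat}.
Implicit Types (T : 'M[R]_N) (f g : R -> R).

(** The matrix [fun_mx f T] before its real part is taken. For a fixed [T] it is
    a ring morphism in [f] and therefore easier to compute with. *)
Definition spectral_conj T f : 'M[R[i]]_N :=
  invmx (spectralmx (toC T))
    *m diag_mx (\row_j real_complex R (f (eigval T j))) *m spectralmx (toC T).

Lemma spectral_conj_id T : T \is symmetricmx -> spectral_conj T id = toC T.
Proof. by move=> /symmetric_toC. Qed.

Lemma spectral_conj_cst T a : spectral_conj T (fun=> a) = toC a%:M.
Proof.
rewrite /spectral_conj.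
have -> : diag_mx (\row_(j < N) real_complex R a) = (real_complex R a)%:M.
  by rewrite -diag_const_mx; congr diag_mx; apply/rowP => j; rewrite !mxE.
rewrite scalar_mxC -mulmxA mulVmx ?spectral_unit// mulmx1.
by rewrite /toC map_scalar_mx.
Qed.

Lemma spectral_conjD T f g :
  spectral_conj T f + spectral_conj T g = spectral_conj T (fun x => f x + g x).
Proof.
rewrite /spectral_conj -mulmxDl -mulmxDr -linearD /=.
congr (_ *m diag_mx _ *m _).
by apply/rowP => j; rewrite !mxE rmorphD.
Qed.

Lemma spectral_conjM T f g :
  spectral_conj T f *m spectral_conj T g = spectral_conj T (fun x => f x * g x).
Proof.
rewrite /spectral_conj !mulmxA; congr (_ *m _).
rewrite -[X in X *m diag_mx _]mulmxA mulmxV ?spectral_unit// mulmx1.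
rewrite -mulmxA mulmx_diag; congr (_ *m diag_mx _).
by apply/rowP => j; rewrite !mxE rmorphM.
Qed.

Lemma spectral_conjX T f n :
  spectral_conj T f ^+ n = spectral_conj T (fun x => f x ^+ n).
Proof.
elim: n => [|n ih].
  rewrite expr0.
  rewrite (_ : (fun=> _) = (fun=> 1 : R)); last by apply/funext => x; rewrite expr0.
  by rewrite spectral_conj_cst /toC map_mx1.
rewrite exprS ih.
rewrite (_ : (fun x => f x ^+ n.+1) = (fun x => f x * f x ^+ n)); last first.
  by apply/funext => x; rewrite exprS.
exact: spectral_conjM.
Qed.

Lemma trace_spectral_conj T f :
  \tr (spectral_conj T f) = real_complex R (\sum_(j < N) f (eigval T j)).
Proof.
rewrite /spectral_conj mxtrace_mulC mulmxA mulmxV ?spectral_unit// mul1mx.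
by rewrite mxtrace_diag rmorph_sum; apply: eq_bigr => j _; rewrite mxE.
Qed.

Lemma spectral_conj_inv T f : (forall x, f x != 0) ->
  spectral_conj T f *m spectral_conj T (fun x => (f x)^-1) = 1%:M.
Proof.
move=> f0; rewrite spectral_conjM (_ : (fun x => _) = (fun=> 1)).
  by rewrite spectral_conj_cst /toC map_mx1.
by apply/funext => x; rewrite divff.
Qed.

Lemma spectral_conj_unit T (M : 'M[R]_N) f : (forall x, f x != 0) ->
  toC M = spectral_conj T f -> M \in unitmx.
Proof.
move=> f0 MT; have [+ _] := mulmx1_unit (spectral_conj_inv T f0).
by rewrite -MT /toC map_unitmx.
Qed.

Lemma trace_invmx_spectral T (M : 'M[R]_N) f : (forall x, f x != 0) ->
  toC M = spectral_conj T f ->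
  \tr (invmx M) = \sum_(j < N) (f (eigval T j))^-1.
Proof.
move=> f0 MT; have [uT _] := mulmx1_unit (spectral_conj_inv T f0).
apply: (@complexI R); rewrite -(trace_spectral_conj T (fun x => (f x)^-1)).
rewrite -[LHS](trace_map_mx (real_complex R)) map_invmx -/(toC M) MT.
by rewrite -[invmx _]mulmx1 -(spectral_conj_inv T f0) mulmxA mulVmx// mul1mx.
Qed.

Lemma norm_det_eigval T : T \is symmetricmx ->
  `|\det T| = \prod_(j < N) `|eigval T j|.
Proof.
move=> /char_poly_eigval chT.
have := char_poly_det T; rewrite chT.
rewrite -horner_coef0 horner_prod => /(congr1 Num.norm).
rewrite normrM normrX normrN1 expr1n mul1r => <-.
rewrite normr_prod; apply: eq_bigr => j _.
by rewrite !hornerE normrN.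
Qed.

Lemma eigenvalue_eigval T x : T \is symmetricmx ->
  eigenvalue T x <-> exists j, eigval T j = x.
Proof.
move=> /char_poly_eigval chT; rewrite eigenvalue_root_char chT /root horner_prod.
split=> [/prodf_eq0[j _]|[j <-]].
  by rewrite hornerXsubC subr_eq0 => /eqP ->; exists j.
by apply/prodf_eq0; exists j; rewrite // hornerXsubC subrr.
Qed.

End SpectralCalculus.

(** * Measurability of matrix operations *)

Section MatrixMeasurability.
Context {d} {Omega : measurableType d} {R : realType}.

Definition measurable_mx m n (A : Omega -> 'M[R]_(m, n)) :=
  forall i j, measurable_fun [set: Omega] (fun w => A w i j).

Lemma measurable_mx_cst m n (A : 'M[R]_(m, n)) : measurable_mx (fun=> A).
Proof. by move=> i j; exact: measurable_cst. Qed.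

Lemma measurable_mxD m n (A B : Omega -> 'M[R]_(m, n)) :
  measurable_mx A -> measurable_mx B -> measurable_mx (fun w => A w + B w).
Proof.
move=> mA mB i j; under eq_fun do rewrite mxE.
exact: measurable_funD.
Qed.

Lemma measurable_mxM m n p (A : Omega -> 'M[R]_(m, n)) (B : Omega -> 'M[R]_(n, p)) :
  measurable_mx A -> measurable_mx B -> measurable_mx (fun w => A w *m B w).
Proof.
move=> mA mB i j; under eq_fun do rewrite mxE.
by apply: measurable_sum => k; exact: measurable_funM.
Qed.

Lemma measurable_mxX n k (A : Omega -> 'M[R]_n) :
  measurable_mx A -> measurable_mx (fun w => A w ^+ k).
Proof.
move=> mA; elim: k => [|k ih]; first exact: measurable_mx_cst.
move=> i j; under eq_fun do rewrite exprS.
exact: measurable_mxM.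
Qed.

Lemma measurable_det n (A : Omega -> 'M[R]_n) :
  measurable_mx A -> measurable_fun [set: Omega] (fun w => \det (A w)).
Proof.
move=> mA; apply: measurable_sum => s.
apply: measurable_funM => //.
by apply: measurable_prod => k _; exact: mA.
Qed.

Lemma measurable_trace n (A : Omega -> 'M[R]_n) :
  measurable_mx A -> measurable_fun [set: Omega] (fun w => \tr (A w)).
Proof. by move=> mA; apply: measurable_sum => k; exact: mA. Qed.

Lemma measurable_funV (f : Omega -> R) : measurable_fun [set: Omega] f ->
  measurable_fun [set: Omega] (fun w => (f w)^-1).
Proof.
move=> mf.
(* x^-1 = x * (x^2)^-1, where the second inverse is a real power *)
under eq_fun => w.
  rewrite (_ : (f w)^-1 = f w * (f w ^+ 2) `^ (-1)); last first.
    rewrite powR_inv1 ?sqr_ge0//; have [->|f0] := eqVneq (f w) 0.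
      by rewrite invr0 mul0r.
    by rewrite expr2 invfM mulrA divff// mul1r.
  over.
apply: measurable_funM => //.
apply: (measurableT_comp (f := fun x : R => x `^ (-1))).
  exact: measurable_powR.
exact: measurable_funX.
Qed.

Lemma measurable_invmx n (A : Omega -> 'M[R]_n) : (forall w, A w \in unitmx) ->
  measurable_mx A -> measurable_mx (fun w => invmx (A w)).
Proof.
move=> uA mA i j; rewrite /invmx; under eq_fun do rewrite uA !mxE.
apply: measurable_funM.
  exact/measurable_funV/measurable_det.
apply: measurable_funM => //; apply: measurable_det => k l.
by under eq_fun do rewrite !mxE; exact: mA.
Qed.

End MatrixMeasurability.

(** * The random empirical spectral measure *)

Section Approx.
Context {R : realType}.

Lemma cvg_sum_ord n (u : 'I_n -> R^nat) (l : 'I_n -> R) :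
  (forall i, u i @ \oo --> l i) ->
  (fun k => \sum_(i < n) u i k) @ \oo --> \sum_(i < n) l i.
Proof.
move=> ul; elim: (index_enum 'I_n) => [|i s ih].
  by rewrite big_nil; under eq_fun do rewrite big_nil; exact: cvg_cst.
by rewrite big_cons; under eq_fun do rewrite big_cons; exact: cvgD.
Qed.

(** The pointwise limit of the rational functions [1 / (1 + z ^ k)]. *)
Definition half_step (z : R) : R :=
  if z < 1 then 1 else if z == 1 then 2^-1 else 0.

Lemma cvg_half_step (z : R) : 0 <= z ->
  (fun k => (1 + z ^+ k)^-1) @ \oo --> half_step z.
Proof.
move=> z0; rewrite /half_step; case: ltgtP => [z1|z1|->].
- rewrite -[X in _ --> X]invr1; apply: cvgV; first exact: oner_neq0.
  rewrite -[X in _ --> X]addr0; apply: cvgD; first exact: cvg_cst.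
  by apply: cvg_expr; rewrite ger0_norm.
- apply: (squeeze_cvgr (f := fun=> 0) (h := fun k => (z^-1) ^+ k)).
  + near=> k; rewrite invr_ge0 addr_ge0 ?exprn_ge0//= exprVn.
    rewrite lef_pV2 ?posrE ?exprn_gt0 ?(lt_trans _ z1)//.
      by rewrite lerDr.
    by rewrite ltr_pwDl ?exprn_ge0.
  + exact: cvg_cst.
  + apply: cvg_expr; rewrite ger0_norm ?invr_ge0//.
    by rewrite invf_lt1// (lt_trans _ z1).
- by under eq_fun do rewrite expr1n; exact: cvg_cst.
Unshelve. all: by end_near.
Qed.

(** The affine map that sends to [[-1, 1]] the ball centred at [a + m] of radius
    [m - 1/m], where [m = n + 2]. These balls increase to the ray [x > a] and each
    closure lies inside the next ball, so that the value of [half_step] at 1 does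
    not survive in the limit. *)
Definition ray_approx (a : R) (n : nat) (x : R) : R :=
  (n.+2%:R - n.+2%:R^-1)^-1 * (x - (a + n.+2%:R)).

Lemma cvg_ray_approx (a x : R) :
  (fun n => half_step (ray_approx a n x ^+ 2)) @ \oo --> ((a < x)%R%:R : R).
Proof.
have mV n : n.+2%:R^-1 <= 1 :> R by rewrite invf_le1 ?ler1n.
have r0 n : 0 < n.+2%:R - n.+2%:R^-1 :> R.
  rewrite subr_gt0 (le_lt_trans (mV n))//.
  by rewrite ltr1n.
have [ax|xa] := ltP a x; last first.
  apply: cvg_near_cst; apply: nearW => n; rewrite /half_step.
  suff h : 1 < ray_approx a n x ^+ 2 by rewrite ltNge (ltW h)/= gt_eqF.
  rewrite -sqrrN exprn_egt1// /ray_approx -mulrN mulrC ltr_pdivlMr// mul1r.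
  have aux (m v : R) : 0 < v -> m - v < - (x - (a + m)) by move=> v0; lra.
  by apply: aux; rewrite invr_gt0.
apply: cvg_near_cst; near=> n; rewrite /half_step.
suff -> : ray_approx a n x ^+ 2 < 1 by [].
rewrite -real_normK ?num_real// exprn_ilt1//.
rewrite /ray_approx normrM gtr0_norm ?invr_gt0// mulrC ltr_pdivrMr// mul1r.
have h1 : n.+2%:R^-1 < x - a.
  rewrite invf_plt ?posrE ?subr_gt0//.
  rewrite (@lt_trans _ _ n%:R)// ?ltr_nat//.
  near: n; exact: nbhs_infty_gtr.
have h2 : x - a < n.+2%:R.
  rewrite (@lt_trans _ _ n%:R)// ?ltr_nat//.
  near: n; exact: nbhs_infty_gtr.
have aux (m v : R) : v < x - a -> x - a < m -> 0 < m - v ->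
    `|x - (a + m)| < m - v.
  by move=> vx xm vm; rewrite ltr_norml; apply/andP; split; lra.
exact: aux.
Unshelve. all: by end_near.
Qed.

End Approx.

Section EmpiricalMeasure.
Context {R : realType} {N : nat}.
Implicit Types (T : 'M[R]_N).
Local Open Scope ereal_scope.

(* [msum] takes measures indexed by natural numbers *)
Let eigval_nat T (k : nat) : R := oapp (eigval T) 0%R (insub k).

Let Vnat_ge0 : (0 <= N%:R^-1 :> R)%R. Proof. by rewrite invr_ge0. Qed.

Let emp_specE T : emp_spec T =
  mscale (NngNum Vnat_ge0) (msum (fun k => \d_(eigval_nat T k)) N).
Proof.
apply/funext => A; rewrite /emp_spec /mscale /msum; congr (_ * _)%E.
by apply: eq_bigr => j _; rewrite /eigval_nat valK.
Qed.

Let emp_spec0 T : emp_spec T set0 = 0.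
Proof. by rewrite emp_specE measure0. Qed.

Let emp_spec_ge0 T A : 0 <= emp_spec T A.
Proof. by rewrite emp_specE measure_ge0. Qed.

Let emp_spec_additive T : semi_sigma_additive (emp_spec T).
Proof. by rewrite emp_specE; exact: measure_semi_sigma_additive. Qed.

HB.instance Definition _ T := isMeasure.Build _ _ _ (emp_spec T)
  (emp_spec0 T) (emp_spec_ge0 T) (@emp_spec_additive T).

Lemma emp_spec_setT T : emp_spec T setT = (N%:R^-1 * N%:R)%:E.
Proof.
rewrite /emp_spec (eq_bigr (fun=> 1%:E)) => [|j _]; last by rewrite diracT.
by rewrite sumEFin sumr_const card_ord.
Qed.

Let emp_spec_le1 T : emp_spec T setT <= 1.
Proof.
rewrite emp_spec_setT lee_fin.
have [->|N0] := posnP N; first by rewrite mulr0.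
by rewrite mulVf// pnatr_eq0 -lt0n.
Qed.

HB.instance Definition _ T := Measure_isSubProbability.Build _ _ _
  (emp_spec T) (emp_spec_le1 T).

Lemma integral_emp_spec T (f : R -> \bar R) :
  measurable_fun [set: R] f -> (forall x, 0 <= f x) ->
  \int[emp_spec T]_x f x = (N%:R^-1)%:E * \sum_(j < N) f (eigval T j).
Proof.
move=> mf f0; rewrite emp_specE ge0_integral_mscale//; congr (_ * _).
rewrite ge0_integral_measure_sum//.
by apply: eq_bigr => j _; rewrite integral_dirac// diracT mul1e /eigval_nat valK.
Qed.

End EmpiricalMeasure.

Section SetFunctionIntegral.
Local Open Scope ereal_scope.
Import HBNNSimple.

(** An integral is a supremum over simple functions, hence depends only on the
    values of the set function on measurable sets. This is stated for bare set
    functions because [avg_emp_spec] is one. *)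
Lemma eq_set_fun_integral d (T : measurableType d) (R : realType)
    (m1 m2 : set T -> \bar R) (f : T -> \bar R) :
  (forall A, measurable A -> m1 A = m2 A) ->
  \int[m1]_x f x = \int[m2]_x f x.
Proof.
move=> m12; rewrite /integral.
by congr (ereal_sup _ - ereal_sup _); apply/seteqP; split => _ [h hf <-];
  exists h => //; apply: eq_fsbigr => r _; rewrite m12.
Qed.

End SetFunctionIntegral.

Section RandomSpectrum.
Context d {Omega : measurableType d} {R : realType} {N : nat}.
Variable H : Omega -> 'M[R]_N.
Hypothesis H_rand : random_symmx H.

Let mH : measurable_mx H. Proof. by case: H_rand. Qed.
Let sH w : H w \is symmetricmx. Proof. by case: H_rand. Qed.

(** The sum is the trace of the inverse of a polynomial in [H w]. *)
Lemma measurable_trace_rational (r a : R) k : measurable_fun [set: Omega]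
  (fun w => \sum_(j < N) (1 + ((r * (eigval (H w) j - a)) ^+ 2) ^+ k)^-1).
Proof.
pose M w := 1%:M + ((r%:M *m (H w + (- a)%:M)) ^+ 2) ^+ k.
have MT w : toC (M w) =
    spectral_conj (H w) (fun x => 1 + ((r * (x + (- a))) ^+ 2) ^+ k).
  rewrite /M /toC map_mxD -/(toC 1%:M) !rmorphXn /= map_mxM /= map_mxD /=.
  rewrite -!/(toC _) -(spectral_conj_id (sH w)) -!(spectral_conj_cst (H w)).
  by rewrite spectral_conjD spectral_conjM !spectral_conjX spectral_conjD.
have pos x : 0 < 1 + ((r * (x + (- a))) ^+ 2) ^+ k.
  by rewrite ltr_pwDl// exprn_ge0// sqr_ge0.
rewrite (_ : (fun w => _) = (fun w => \tr (invmx (M w)))); last first.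
  apply/funext => w; rewrite (trace_invmx_spectral _ (MT w))// => x.
  by rewrite gt_eqF.
apply/measurable_trace/measurable_invmx.
  move=> w; apply: (@spectral_conj_unit _ _ (H w)) (MT w) => x.
  by rewrite gt_eqF.
apply: measurable_mxD; first exact: measurable_mx_cst.
apply: measurable_mxX; apply: measurable_mxX; apply: measurable_mxM.
  exact: measurable_mx_cst.
by apply: measurable_mxD => //; exact: measurable_mx_cst.
Qed.

Lemma measurable_count_ray (a : R) : measurable_fun [set: Omega]
  (fun w => \sum_(j < N) ((a < eigval (H w) j)%R%:R : R)).
Proof.
apply: (measurable_fun_cvg
  (h := fun n w => \sum_(j < N) half_step (ray_approx a n (eigval (H w) j) ^+ 2))).
  move=> n; apply: (measurable_fun_cvg
    (h := fun k w =>
      \sum_(j < N) (1 + (ray_approx a n (eigval (H w) j) ^+ 2) ^+ k)^-1)).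
    by move=> k; exact: measurable_trace_rational.
  by move=> w _; apply: cvg_sum_ord => j; apply: cvg_half_step; exact: sqr_ge0.
by move=> w _; apply: cvg_sum_ord => j; exact: cvg_ray_approx.
Qed.

Local Open Scope ereal_scope.

(** Open rays form a pi-system that generates the Borel sets, so the case of
    rays ([measurable_count_ray]) suffices. *)
Lemma measurable_emp_spec_ev (A : set R) : measurable A ->
  measurable_fun [set: Omega] (fun w => emp_spec (H w) A).
Proof.
pose D := [set A : set R | measurable A /\
  measurable_fun [set: Omega] (fun w => emp_spec (H w) A)].
have dynD : dynkin D.
  split.
  - split=> //; under eq_fun do rewrite emp_spec_setT; exact: measurable_cst.
  - move=> B [mB mfB]; split; first exact: measurableC.
    rewrite (_ : (fun w => _) =
      (fun w => (N%:R^-1 * N%:R)%:E - emp_spec (H w) B)).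
      by apply: emeasurable_funB.
    apply/funext => w; rewrite -setTD measureD//=; last by rewrite emp_spec_setT ltry.
    by rewrite setTI emp_spec_setT.
  - move=> F tF DF; split; first by apply: bigcupT_measurable => k; case: (DF k).
    rewrite (_ : (fun w => _) = (fun w => \sum_(k <oo) emp_spec (H w) (F k))).
      by apply: ge0_emeasurable_sum => // k _; case: (DF k).
    apply/funext => w; rewrite measure_bigcup//; last by move=> k _; case: (DF k).
    by apply: eq_eseriesl => k; rewrite in_setT.
have GD : @RGenOInfty.G R `<=` D.
  move=> _ [x ->]; split; first exact: measurable_itv.
  rewrite /emp_spec; apply: measurable_funeM.
  rewrite (_ : (fun w => _) =
    EFin \o (fun w => \sum_(j < N) ((x < eigval (H w) j)%R%:R : R))%R).
    exact/measurable_EFinP/measurable_count_ray.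
  apply/funext => w /=; rewrite -sumEFin; apply: eq_bigr => j _.
  by rewrite diracE mem_setE in_itv/= andbT.
have GI : setI_closed (@RGenOInfty.G R).
  move=> _ _ [x ->] [y ->]; exists (Num.max x y).
  by apply/seteqP; split => z /=; rewrite !in_itv/= !andbT gt_max => /andP.
move=> mA; suff [] : D A by [].
have : <<s @RGenOInfty.G R >> A.
  by move: mA; rewrite [measurable]RGenOInfty.measurableE.
rewrite -(setI_closed_g_dynkin_g_sigma_algebra GI).
by apply: smallest_sub.
Qed.

Definition random_spec (w : Omega) : giry R R := emp_spec (H w).

Lemma measurable_random_spec : measurable_fun [set: Omega] random_spec.
Proof.
by apply: measurable_giry_codensity => // B mB; exact: measurable_emp_spec_ev.
Qed.

Lemma ge0_measurable_trace (f : R -> \bar R) :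
  measurable_fun [set: R] f -> (forall x, 0 <= f x) ->
  measurable_fun [set: Omega]
    (fun w => (N%:R^-1)%:E * \sum_(j < N) f (eigval (H w) j)).
Proof.
move=> mf f0.
rewrite (_ : (fun w => _) = giry_int^~ f \o random_spec).
  apply: measurableT_comp; first exact: measurable_giry_int.
  exact: measurable_random_spec.
by apply/funext => w /=; rewrite /giry_int integral_emp_spec.
Qed.

Variable P : probability Omega R.

(** For a measurable [A], evaluation at [A] is measurable on the space of
    subprobability measures, so that the integral is carried by [random_spec]. *)
Lemma avg_emp_specE (A : set R) : measurable A ->
  avg_emp_spec P H A =
  giry_bind (P : giry Omega R) measurable_random_spec A.
Proof.
move=> mA; rewrite /avg_emp_spec /giry_bind /=; symmetry.
by rewrite /giry_join giry_int_map//; exact: measurable_giry_ev.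
Qed.

Lemma ge0_integral_avg_emp_spec (f : R -> \bar R) :
  measurable_fun [set: R] f -> (forall x, 0 <= f x) ->
  \int[avg_emp_spec P H]_x f x =
  \int[P]_w ((N%:R^-1)%:E * \sum_(j < N) f (eigval (H w) j)).
Proof.
move=> mf f0; rewrite (eq_set_fun_integral _ avg_emp_specE).
transitivity
  (giry_int (giry_bind (P : giry Omega R) measurable_random_spec) f); first by [].
rewrite giry_int_bind//; apply: eq_integral => w _.
by rewrite /giry_int integral_emp_spec.
Qed.

End RandomSpectrum.

(** * Lipschitz linear statistics *)

Section Lipschitz.
Context {R : realType}.
Implicit Types (f g : R -> R) (L : R).

Lemma klipschitzP L f :
  L.-lipschitz f <-> forall x y, `|f x - f y| <= L * `|x - y|.
Proof.
by split=> [fL x y|fL [x y] _]; [exact: (fL (x, y))|exact: fL].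
Qed.

Lemma klipschitz_continuous L f : L.-lipschitz f -> continuous f.
Proof.
move=> /klipschitzP fL x; apply/cvgrPdist_le => e e0.
near=> y; rewrite (le_trans (fL x y))//.
have L1 : 0 < `|L| + 1 by rewrite ltr_wpDl.
rewrite (@le_trans _ _ ((`|L| + 1) * `|x - y|))//.
  by rewrite ler_wpM2r// (le_trans (ler_norm L))// lerDl.
rewrite mulrC -ler_pdivlMr//.
by near: y; apply: cvgr_dist_le; [exact: cvg_id|exact: divr_gt0].
Unshelve. all: by end_near.
Qed.

Lemma klipschitz_measurable L f :
  L.-lipschitz f -> measurable_fun [set: R] f.
Proof.
by move=> /klipschitz_continuous; exact: continuous_measurable_fun.
Qed.

Lemma klipschitz_le L f x : L.-lipschitz f ->
  `|f x| <= `|f 0| + L * `|x|.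
Proof.
move=> /klipschitzP fL; rewrite -[f x](subrK (f 0)) [leRHS]addrC.
by rewrite (le_trans (ler_normD _ _))// lerD2r (le_trans (fL _ _))// subr0.
Qed.

Lemma lip_norm_le L f : L.-lipschitz f -> (lip_norm f <= L%:E)%E.
Proof.
move=> /klipschitzP fL; apply: ge_ereal_sup => _ [[x y] /= xy <-].
by rewrite lee_fin ler_pdivrMr// normr_gt0 subr_eq0.
Qed.

Lemma klipschitz_lipschitz L f : L.-lipschitz f ->
  [lipschitz f x | x in [set: R]].
Proof.
move=> /klipschitzP fL; exists L; split; first exact: num_real.
move=> M LM; apply/klipschitzP => x y; rewrite (le_trans (fL _ _))//.
by rewrite ler_wpM2r// ltW.
Qed.

Lemma klipschitzZ c L f : L.-lipschitz f ->
  (`|c| * L).-lipschitz (fun x => c * f x).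
Proof.
move=> /klipschitzP fL; apply/klipschitzP => x y.
by rewrite -mulrBr normrM -mulrA ler_wpM2l.
Qed.

End Lipschitz.

Section MeanSpec.
Context d {Omega : measurableType d} {R : realType} {N : nat}.
Variable H : Omega -> 'M[R]_N.
Hypothesis H_rand : random_symmx H.
Variable P : probability Omega R.

(** This is [\tr (fun_mx f (H w)) / N], by [mxtrace_fun_mx]. *)
Definition mean_spec (f : R -> R) (w : Omega) : R :=
  N%:R^-1 * \sum_(j < N) f (eigval (H w) j).

Let mean_specE f w :
  (mean_spec f w)%:E = ((N%:R^-1)%:E * \sum_(j < N) (f (eigval (H w) j))%:E)%E.
Proof. by rewrite EFinM sumEFin. Qed.

Let ge0_measurable_mean_spec (f : R -> R) : measurable_fun [set: R] f ->
  (forall x, 0 <= f x :> R) -> measurable_fun [set: Omega] (mean_spec f).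
Proof.
move=> mf f0; apply/measurable_EFinP.
rewrite (_ : EFin \o _ =
  (fun w => (N%:R^-1)%:E * \sum_(j < N) (f (eigval (H w) j))%:E)%E).
  by apply: (ge0_measurable_trace H_rand (f := EFin \o f)) => //;
    exact/measurable_EFinP.
by apply/funext => w /=; rewrite mean_specE.
Qed.

Let mean_spec_posneg f :
  mean_spec f = (fun w => mean_spec (f^\+) w - mean_spec (f^\-) w).
Proof.
apply/funext => w; rewrite /mean_spec -mulrBr -sumrB; congr (_ * _).
by apply: eq_bigr => j _; rewrite -{1}(funrposBneg f).
Qed.

Lemma measurable_mean_spec f : measurable_fun [set: R] f ->
  measurable_fun [set: Omega] (mean_spec f).
Proof.
move=> mf; rewrite mean_spec_posneg; apply: measurable_funB.
  by apply: ge0_measurable_mean_spec => //; exact: measurable_funrpos.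
by apply: ge0_measurable_mean_spec => //; exact: measurable_funrneg.
Qed.

Local Open Scope ereal_scope.

Let ge0_integral_avg (f : R -> R) :
  measurable_fun [set: R] f -> (forall x, 0 <= f x)%R ->
  \int[avg_emp_spec P H]_x (f x)%:E = \int[P]_w (mean_spec f w)%:E.
Proof.
move=> mf f0; rewrite (ge0_integral_avg_emp_spec H_rand P (f := EFin \o f))//.
  by apply: eq_integral => w _; rewrite mean_specE.
exact/measurable_EFinP.
Qed.

Lemma integrable_mean_spec (f : R -> R) : measurable_fun [set: R] f ->
  \int[avg_emp_spec P H]_x `|f x|%:E < +oo ->
  P.-integrable [set: Omega] (EFin \o mean_spec f).
Proof.
move=> mf foo; apply/integrableP; split.
  exact/measurable_EFinP/measurable_mean_spec.
apply: le_lt_trans foo; rewrite ge0_integral_avg//; last first.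
  exact: measurableT_comp.
apply: ge0_le_integral => //.
- apply/measurable_EFinP/measurableT_comp => //.
  exact: measurable_mean_spec.
- by apply/measurable_EFinP/measurable_mean_spec/measurableT_comp.
move=> w _; rewrite lee_fin normrM ger0_norm// ler_wpM2l//.
exact: ler_norm_sum.
Qed.

Lemma integral_avg_emp_spec (f : R -> R) : measurable_fun [set: R] f ->
  \int[avg_emp_spec P H]_x `|f x|%:E < +oo ->
  \int[avg_emp_spec P H]_x (f x)%:E = \int[P]_w (mean_spec f w)%:E.
Proof.
move=> mf foo.
have mfp := measurable_funrpos mf; have mfn := measurable_funrneg mf.
have ig (g : R -> R) : measurable_fun [set: R] g -> (forall x, 0 <= g x)%R ->
    (forall x, g x <= `|f x|)%R -> P.-integrable [set: Omega] (EFin \o mean_spec g).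
  move=> mg g0 gf; apply: integrable_mean_spec => //; apply: le_lt_trans foo.
  rewrite !ge0_integral_avg//; do ?exact: measurableT_comp.
  apply: ge0_le_integral => //.
  - by move=> w _; rewrite lee_fin mulr_ge0// sumr_ge0.
  - by apply/measurable_EFinP/measurable_mean_spec/measurableT_comp.
  - by apply/measurable_EFinP/measurable_mean_spec/measurableT_comp.
  move=> w _; rewrite lee_fin ler_wpM2l// ler_sum// => j _.
  by rewrite ger0_norm.
have fE x : `|f x|%R = (f^\+ x + f^\- x)%R.
  by rewrite -[LHS]/((Num.norm \o f) x) -funrposDneg.
have ip : P.-integrable [set: Omega] (EFin \o mean_spec f^\+%R).
  by apply: ig => // x; rewrite fE lerDl.
have im : P.-integrable [set: Omega] (EFin \o mean_spec f^\-%R).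
  by apply: ig => // x; rewrite fE lerDr.
rewrite mean_spec_posneg integralB_EFin// -!ge0_integral_avg//.
pose nu := giry_bind (P : giry Omega R) (measurable_random_spec H_rand).
have avg_nu A : measurable A -> avg_emp_spec P H A = nu A.
  exact: avg_emp_specE.
rewrite !(eq_set_fun_integral _ avg_nu) integralE.
by rewrite -[X in \int[nu]_x (X^\+ x) - _]/(EFin \o f) funerpos funerneg.
Qed.

End MeanSpec.

(** * The logarithmic potential of a measure with a power-law density *)

Lemma nneseries_geometric (R : realType) (a z : R) : 0 <= a -> 0 <= z < 1 ->
  (\sum_(k <oo) (a * z ^+ k)%:E)%E = (a / (1 - z))%:E.
Proof.
move=> a0 /andP[z0 z1]; apply/cvg_lim => //.
under eq_fun do rewrite sumEFin.
apply: cvg_EFin; first by apply: nearW.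
by apply: cvg_geometric_series; rewrite ger0_norm.
Qed.

Section LogMax.
Context {R : realType}.
Implicit Types (eta x : R).

(** The logarithm truncated at distance [eta] from its singularity. *)
Definition logmax eta x : R := ln (Num.max `|x| eta).

Lemma le_ln_div (a b : R) : 0 < a -> 0 < b -> ln a - ln b <= (a - b) / b.
Proof.
move=> a0 b0; rewrite -ln_div ?posrE// mulrBl divff ?gt_eqF//.
have := expR_ge1Dx (ln (a / b)); rewrite lnK ?posrE ?divr_gt0//.
by rewrite lerBrDl.
Qed.

Lemma max_dist (a b c : R) : `|Num.max a c - Num.max b c| <= `|a - b|.
Proof.
have h1 := ler_norm (a - b); have := ler_norm (b - a); rewrite distrC => h2.
rewrite ler_norml.
by case: (leP a c) => ac; case: (leP b c) => bc; apply/andP; split; lra.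
Qed.

Lemma klipschitz_logmax eta : 0 < eta -> eta^-1.-lipschitz (logmax eta).
Proof.
move=> eta0; apply/klipschitzP => x y.
have pos (z : R) : 0 < Num.max `|z| eta by rewrite lt_max eta0 orbT.
have h (u v : R) : ln (Num.max `|u| eta) - ln (Num.max `|v| eta) <= eta^-1 * `|u - v|.
  rewrite (le_trans (le_ln_div _ _))//.
  rewrite mulrC (@le_trans _ _ ((Num.max `|v| eta)^-1 * `|u - v|))//.
    rewrite ler_wpM2l//; first by rewrite invr_ge0 ltW.
    rewrite (le_trans (ler_norm _))// (le_trans (max_dist _ _ _))//.
    exact: ler_dist_dist.
  by rewrite ler_wpM2r// lef_pV2 ?posrE// le_max lexx orbT.
rewrite ler_norml h andbT lerNl opprB (le_trans (h _ _))//.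
by rewrite distrC.
Qed.

Lemma ln_le_logmax eta x : 0 < eta -> x != 0 -> ln `|x| <= logmax eta x.
Proof.
move=> eta0 x0; rewrite ler_ln ?posrE ?normr_gt0//.
  by rewrite le_max lexx.
by rewrite lt_max eta0 orbT.
Qed.

Definition sym_itv (s : R) : set R := [set x | `|x| <= s].

Lemma sym_itvE s : sym_itv s = `[- s, s]%classic.
Proof. by apply/seteqP; split => x; rewrite /sym_itv/= in_itv/= ler_norml. Qed.

Lemma measurable_sym_itv s : measurable (sym_itv s).
Proof. by rewrite sym_itvE; exact: measurable_itv. Qed.

Lemma setC_sym_itv s : ~` sym_itv s = [set x | s < `|x|].
Proof. by apply/seteqP; split => x; rewrite /sym_itv/= ltNge => /negP. Qed.

Definition shell (r : R) : set R := [set x | r * expR (- 1) < `|x| <= r].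

Lemma measurable_shell r : measurable (shell r).
Proof.
rewrite (_ : shell r = sym_itv r `\` sym_itv (r * expR (- 1))).
  by apply: measurableD; exact: measurable_sym_itv.
apply/seteqP; split => x; rewrite /shell /sym_itv/= ltNge.
  by move=> /andP[/negP].
by move=> [-> /negP ->].
Qed.

Let ln_scale eta n : 0 < eta -> ln (eta * expR (- n%:R)) = ln eta - n%:R.
Proof. by move=> eta0; rewrite lnM ?posrE ?expR_gt0// expRK. Qed.

Lemma least_scale eta x : 0 < eta -> x != 0 ->
  exists2 n, eta * expR (- n%:R) < `|x|
           & forall k, (k < n)%N -> `|x| <= eta * expR (- k%:R).
Proof.
move=> eta0 x0.
have exn : exists n, eta * expR (- n%:R) < `|x|.
  exists (Num.trunc (ln eta - ln `|x|)).+1.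
  rewrite -ltr_ln ?posrE ?mulr_gt0 ?expR_gt0 ?normr_gt0// ln_scale//.
  by rewrite ltrBlDr -ltrBlDl truncnS_gt.
have [n nx nmin] := ex_minnP exn; exists n => // k kn.
by rewrite leNgt; apply/negP => /nmin; rewrite leqNgt kn.
Qed.

(** The error made by truncating the logarithm is at most the number of scales
    [eta * exp (- k)] that lie above [|x|]. *)
Lemma logmax_le_count eta x : 0 < eta -> x != 0 ->
  ((logmax eta x - ln `|x|)%:E
    <= \sum_(k <oo) (\1_(sym_itv (eta * expR (- k%:R))) x : R)%:E)%E.
Proof.
move=> eta0 x0; have x_gt0 : 0 < `|x| by rewrite normr_gt0.
have [n nx xk] := least_scale eta0 x0.
apply: (@le_trans _ _
  (\sum_(0 <= k < n) (\1_(sym_itv (eta * expR (- k%:R))) x : R)%:E)%E).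
  rewrite big_mkord (eq_bigr (fun=> 1%E)) => [|k _]; last first.
    by rewrite indicE mem_set//=; exact: xk.
  rewrite sumEFin lee_fin sumr_const card_ord /logmax.
  have : ln eta - n%:R < ln `|x|.
    by rewrite -ln_scale// ltr_ln ?posrE ?mulr_gt0 ?expR_gt0.
  have : 0 <= n%:R :> R by [].
  by move: (n%:R : R) => m; case: (leP `|x| eta) => _ *; lra.
by apply: nneseries_lim_ge => k _ _; rewrite lee_fin.
Qed.

End LogMax.

Section CompactIntegrable.
Context {R : realType} (mu : probability R R) (M : R).
Hypothesis mu_supp : mu [set x | M < `|x|] = 0%E.

Lemma compact_supp_integrable (f : R -> R) (C : R) :
  measurable_fun [set: R] f -> (forall x, `|x| <= M -> `|f x| <= C) ->
  mu.-integrable [set: R] (EFin \o f).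
Proof.
move=> mf fC; apply/integrableP; split; first exact/measurable_EFinP.
apply: (@le_lt_trans _ _ (`|C|%:E * mu [set: R])%E); last first.
  by rewrite probability_setT mule1 ltry.
apply: integral_le_bound => //; first exact/measurable_EFinP.
exists [set x | M < `|x|]; split => //.
  by rewrite -setC_sym_itv; apply: measurableC; exact: measurable_sym_itv.
move=> x /=; apply: contra_notP => /negP; rewrite -leNgt => xM _.
by rewrite lee_fin (le_trans (fC _ xM))// ler_norm.
Qed.

Lemma klipschitz_integrable L (f : R -> R) : 0 <= L -> L.-lipschitz f ->
  mu.-integrable [set: R] (EFin \o f).
Proof.
move=> L0 fL; apply: (@compact_supp_integrable f (`|f 0| + L * M)).
  exact: klipschitz_measurable fL.
move=> x xM; rewrite (le_trans (klipschitz_le x fL))// lerD2l.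
exact: ler_wpM2l.
Qed.

End CompactIntegrable.

Section PowerDensity.
Context {R : realType} (kappa : R) (mu : probability R R).
Hypothesis kappa_gt0 : 0 < kappa.
Hypothesis mu_density : has_density_near0 kappa mu.
Local Open Scope ereal_scope.

Lemma density_set1 : mu [set 0%R] = 0.
Proof.
case: mu_density => rho [_ _ muE _].
rewrite muE//; first exact: (integral_Sset1 0%R).
by move=> _ ->; rewrite /= in_itv/= oppr_lt0 kappa_gt0.
Qed.

Let C0 := (kappa^-1 * expR 1 * 2)%R.

(** Both [|x| ^ kappa] and [1 / |x|] are controlled by the outer radius of the
    shell, which bounds [|x| ^ (-1 + kappa)] whatever the sign of
    [-1 + kappa]. *)
Lemma density_shell r : (0 < r < kappa)%R ->
  mu (shell r) <= (C0 * r `^ kappa)%:E.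
Proof.
move=> /andP[r0 rk]; set A := shell r.
have mA : measurable A by exact: measurable_shell.
have Ak : A `<=` `](- kappa)%R, kappa[.
  by move=> x /= /andP[_ xr]; rewrite in_itv/= -ltr_norml (le_lt_trans xr).
case: mu_density => rho [mrho rho0 muE rho_le].
have c0 : (0 <= kappa^-1 * (expR 1 / r * r `^ kappa))%R.
  by rewrite !mulr_ge0 ?invr_ge0 ?powR_ge0 ?expR_ge0// ltW.
rewrite muE//.
apply: (@le_trans _ _
  (\int[lebesgue_measure]_(x in A) cst (kappa^-1 * (expR 1 / r * r `^ kappa))%:E x)).
  apply: ge0_le_integral => //.
  - move=> x /Ak; rewrite /= in_itv/= -ltr_norml => xk.
    by rewrite lee_fin rho0.
  - by apply/measurable_EFinP; exact: measurable_funS mrho.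
  move=> x /= /andP[rx xr]; rewrite lee_fin.
  have x0 : (0 < `|x|)%R by rewrite (le_lt_trans _ rx)// mulr_ge0 ?expR_ge0// ltW.
  rewrite (le_trans (ltW (rho_le x _)))//.
    by rewrite x0 (le_lt_trans xr).
  rewrite ler_wpM2l ?invr_ge0 ?(ltW kappa_gt0)//.
  rewrite powRD ?(gt_eqF x0) ?implybT// powR_inv1// ler_pM ?invr_ge0 ?powR_ge0//.
    rewrite -[leRHS]invrK invf_div lef_pV2 ?posrE ?divr_gt0 ?expR_gt0//.
    by rewrite -expRN ltW.
  by rewrite ge0_ler_powR ?nnegrE// ltW.
rewrite integral_cst//.
rewrite (@le_trans _ _ ((kappa^-1 * (expR 1 / r * r `^ kappa))%:E *
  lebesgue_measure `[(- r)%R, r]%classic))//.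
  rewrite lee_wpmul2l ?lee_fin// le_measure ?inE//.
  by rewrite -sym_itvE => x /= /andP[].
rewrite lebesgue_measure_itv/= lte_fin gt0_cp ?ler0N//.
rewrite -EFinD -EFinM lee_fin opprK /C0.
by rewrite le_eqVlt; apply/orP; left; apply/eqP; field; rewrite !gt_eqF.
Qed.

Let z := expR (- kappa).
Let z01 : (0 <= z < 1)%R.
Proof. by rewrite expR_ge0 -expR0 ltr_expR oppr_lt0. Qed.

Definition density_cst : R := (kappa^-1 * expR 1 * 2 / (1 - expR (- kappa)))%R.

Definition potential_cst : R := (density_cst / (1 - expR (- kappa)))%R.

Let density_cst_ge0 : (0 <= density_cst)%R.
Proof.
case/andP: z01 => _ z1.
by rewrite !mulr_ge0 ?invr_ge0 ?expR_ge0// ?subr_ge0 ltW.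
Qed.

Let scaleX (s : R) k : (0 <= s)%R ->
  ((s * expR (- k%:R)) `^ kappa = s `^ kappa * z ^+ k)%R.
Proof.
move=> s0; rewrite powRM ?expR_ge0// /z -expRM_natl -expRM.
by congr (_ * expR _)%R; rewrite mulNr mulrN.
Qed.

Let scale_le (s : R) k : (0 < s)%R -> (0 < s * expR (- k%:R) <= s)%R.
Proof.
by move=> s0; rewrite mulr_gt0 ?expR_gt0//= -[leRHS]mulr1 ler_wpM2l ?(ltW s0).
Qed.

(** The interval is the union of {0} and of the shells of outer radii
    [s * exp (- k)], whose masses form a geometric series. *)
Lemma density_sym_itv s : (0 < s < kappa)%R ->
  mu (sym_itv s) <= (density_cst * s `^ kappa)%:E.
Proof.
move=> /andP[s0 sk].
pose F k := shell (s * expR (- k%:R)).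
have mF k : measurable (F k) by exact: measurable_shell.
have mUF : measurable (\bigcup_k F k) by exact: bigcupT_measurable.
apply: (@le_trans _ _ (mu ([set 0%R] `|` \bigcup_k F k))).
  apply: le_measure; rewrite ?inE; [exact: measurable_sym_itv|exact: measurableU|].
  move=> x xs; have [->|x0] := eqVneq x 0%R; [by left|right].
  have [[|n] nx xk] := least_scale s0 x0.
    by move: nx; rewrite oppr0 expR0 mulr1 ltNge xs.
  exists n => //; rewrite /F /shell/= xk// -mulrA -expRD -opprD -natr1 in nx *.
  by rewrite nx.
apply: (le_trans (measureU2 mu _ mUF)); first exact: measurable_set1.
rewrite [X in X + _]density_set1 add0e.
rewrite (le_trans (measure_sigma_subadditive _ mF mUF _))//.
rewrite (@le_trans _ _
  (\sum_(k <oo) ((kappa^-1 * expR 1 * 2) * s `^ kappa * z ^+ k)%:E))//.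
  apply: lee_nneseries => // k _; rewrite -mulrA -scaleX ?(ltW s0)//.
  apply: density_shell.
  by have /andP[-> h] := scale_le k s0; rewrite (le_lt_trans h).
rewrite nneseries_geometric//; first by rewrite lee_fin mulrAC.
by rewrite !mulr_ge0 ?invr_ge0 ?powR_ge0 ?expR_ge0// ltW.
Qed.

(** The left-hand side is the sum over [k] of the masses of the intervals
    [[- eta exp (- k), eta exp (- k)]], again a geometric series. *)
Lemma integral_count eta : (0 < eta < kappa)%R ->
  \int[mu]_x (\sum_(k <oo) (\1_(sym_itv (eta * expR (- k%:R))) x : R)%:E)
    <= (potential_cst * eta `^ kappa)%:E.
Proof.
move=> /andP[e0 ek].
rewrite integral_nneseries//; last first.
  move=> k; apply/measurable_EFinP/measurable_indic; exact: measurable_sym_itv.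
rewrite (@le_trans _ _
  (\sum_(k <oo) (density_cst * eta `^ kappa * z ^+ k)%:E))//.
  apply: lee_nneseries => [k _ _|k _]; first exact: integral_ge0.
  rewrite integral_indic//; last exact: measurable_sym_itv.
  rewrite setIT -mulrA -scaleX ?(ltW e0)//.
  apply: density_sym_itv.
  by have /andP[-> h] := scale_le k e0; rewrite (le_lt_trans h).
rewrite nneseries_geometric//; first by rewrite lee_fin mulrAC.
by rewrite mulr_ge0 ?powR_ge0.
Qed.

Variable M : R.
Hypothesis mu_supp : mu [set x | (M < `|x|)%R] = 0.

(** In particular the logarithm is integrable, and truncating it costs
    [O(eta ^ kappa)] with a constant that depends only on [kappa]. *)
Lemma integral_logmax eta : (0 < eta < kappa)%R ->
  [/\ \int[mu]_x lne `|x|%:E \is a fin_num,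
      \int[mu]_x lne `|x|%:E <= \int[mu]_x (logmax eta x)%:E &
      \int[mu]_x (logmax eta x)%:E <=
      \int[mu]_x lne `|x|%:E + (potential_cst * eta `^ kappa)%:E].
Proof.
move=> eta0k; have /andP[eta0 _] := eta0k.
(* the value at the null set {0} is irrelevant, and this one makes the
   comparison with [logmax eta] hold everywhere *)
pose g x := if x == 0%R then logmax eta x else ln `|x|.
pose u x := \sum_(k <oo) (\1_(sym_itv (eta * expR (- k%:R))) x : R)%:E.
have u0 x : 0 <= u x by apply: nneseries_ge0 => k _ _; rewrite lee_fin.
have mu_ : measurable_fun [set: R] u.
  apply: ge0_emeasurable_sum => // k _.
  by apply/measurable_EFinP/measurable_indic; exact: measurable_sym_itv.
have mL : measurable_fun [set: R] (logmax eta).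
  exact: klipschitz_measurable (klipschitz_logmax eta0).
have m0 : measurable_fun [set: R] (fun x : R => x == 0%R).
  exact: measurable_fun_eqr.
have mln : measurable_fun [set: R] (fun x : R => ln `|x|).
  by apply: measurableT_comp => //; exact: measurable_ln.
have mg : measurable_fun [set: R] g by exact: measurable_fun_ifT.
have g_le x : (g x <= logmax eta x)%R.
  by rewrite /g; case: ifPn => // x0; exact: ln_le_logmax.
have g_ge x : (logmax eta x - g x)%:E <= u x.
  rewrite /g; case: ifPn => [_|x0]; first by rewrite subrr.
  exact: logmax_le_count.
have iL : mu.-integrable [set: R] (EFin \o logmax eta).
  apply: klipschitz_integrable (klipschitz_logmax eta0); first exact: mu_supp.
  by rewrite invr_ge0 ltW.
have iD : mu.-integrable [set: R] (EFin \o (fun x => logmax eta x - g x)%R).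
  apply/integrableP; split; first exact/measurable_EFinP/measurable_funB.
  apply: (@le_lt_trans _ _ (\int[mu]_x u x)); last first.
    by rewrite (le_lt_trans (integral_count eta0k))// ltry.
  apply: ge0_le_integral => //.
    by apply/measurable_EFinP/measurableT_comp => //; exact: measurable_funB.
  by move=> x _ /=; rewrite ger0_norm ?subr_ge0.
have ig : mu.-integrable [set: R] (EFin \o g).
  have := integrableB measurableT iL iD.
  by apply: eq_integrable => // x _ /=; rewrite -EFinB subKr.
have lneE : \int[mu]_x lne `|x|%:E = \int[mu]_x (g x)%:E.
  have lne0 (x : R) : lne `|x|%:E = if x == 0%R then -oo else (ln `|x|)%:E.
    case: eqVneq => [->|x0]; first by rewrite normr0 le0_lneNy.
    by rewrite lne_EFin// normr_gt0.
  apply: ae_eq_integral => //.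
  - under eq_fun do rewrite lne0.
    by apply: measurable_fun_ifT => //; exact/measurable_EFinP.
  - exact/measurable_EFinP.
  exists [set 0%R]; split => //; first exact: density_set1.
  move=> x /=; apply: contra_notP => /eqP x0 _.
  by rewrite -[LHS]/(lne `|x|%:E) lne0 /g (negbTE x0).
rewrite lneE; split; first exact: integrable_fin_num ig.
  by apply: le_integral => // x _; rewrite lee_fin.
rewrite -leeBlDl; last exact: integrable_fin_num ig.
rewrite -integralB_EFin//.
apply: le_trans (integral_count eta0k).
apply: ge0_le_integral => //.
- by move=> x _; rewrite -EFinB lee_fin subr_ge0.
- by under eq_fun do rewrite -EFinB; exact/measurable_EFinP/measurable_funB.
by move=> x _; rewrite -EFinB g_ge.
Qed.

End PowerDensity.

(** * Means and fluctuations of Lipschitz statistics *)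

Section W1Lipschitz.
Context d {Omega : measurableType d} {R : realType} {N : nat}.
Variables (P : probability Omega R) (H : Omega -> 'M[R]_N).
Hypothesis H_rand : random_symmx H.
Variables (mu : probability R R) (M : R).
Hypothesis mu_supp : mu [set x | M < `|x|] = 0%E.
Variable e : R.
Hypothesis W1_le : (W1 (avg_emp_spec P H) mu <= e%:E)%E.
Local Open Scope ereal_scope.

Let W1_test (f : R -> R) : 1.-lipschitz f ->
  `| \int[avg_emp_spec P H]_x (f x)%:E - \int[mu]_x (f x)%:E | <= e%:E.
Proof.
move=> f1; apply: le_trans W1_le; apply: ereal_sup_ubound; exists f => //=.
exact: lip_norm_le.
Qed.

Let klipschitz_norm : 1.-lipschitz (fun x : R => `|x|%R).
Proof.
by apply/klipschitzP => x y; rewrite mul1r ler_dist_dist.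
Qed.

(** The absolute value is 1-Lipschitz, and its integral against [mu] is finite;
    if the one against the averaged measure were infinite, so would be [W1]. *)
Let first_moment : \int[avg_emp_spec P H]_x `|x|%:E < +oo.
Proof.
have iB := klipschitz_integrable mu_supp ler01 klipschitz_norm.
have := W1_test klipschitz_norm.
have /fineK <- := integrable_fin_num measurableT iB.
by case: (\int[avg_emp_spec P H]_x _) => //= r _; rewrite ltry.
Qed.

Let avg_lipschitz L (f : R -> R) : L.-lipschitz f ->
  \int[avg_emp_spec P H]_x `|f x|%:E < +oo.
Proof.
move=> fL; have mf := klipschitz_measurable fL.
pose nu := giry_bind (P : giry Omega R) (measurable_random_spec H_rand).
have avg_nu A : measurable A -> avg_emp_spec P H A = nu A.
  exact: avg_emp_specE.
have /integrableP[//] : nu.-integrable [set: R] (EFin \o f).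
  have i1 : nu.-integrable [set: R] (fun x => `|x|%:E).
    apply/integrableP; split; first exact/measurable_EFinP.
    under eq_integral do rewrite abse_EFin normr_id.
    by rewrite -(eq_set_fun_integral _ avg_nu).
  have i2 := finite_measure_integrable_cst nu `|f 0%R|%R measurableT.
  have := integrableD measurableT i2 (integrableZl measurableT L i1).
  apply: le_integrable => //; first exact/measurable_EFinP.
  move=> x _ /=; rewrite lee_fin -/(_ + _)%R.
  by rewrite (le_trans (klipschitz_le x fL))// ler_norm.
by move=> _; rewrite (eq_set_fun_integral _ avg_nu).
Qed.

Lemma integrable_mean_klipschitz L (f : R -> R) : L.-lipschitz f ->
  P.-integrable [set: Omega] (EFin \o mean_spec H f).
Proof.
move=> fL; apply: integrable_mean_spec => //; first exact: klipschitz_measurable fL.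
exact: avg_lipschitz fL.
Qed.

Lemma W1_klipschitz L (f : R -> R) : (0 < L)%R -> L.-lipschitz f ->
  `| \int[P]_w (mean_spec H f w)%:E - \int[mu]_x (f x)%:E | <= (L * e)%:E.
Proof.
move=> L0 fL.
have iP := integrable_mean_klipschitz fL.
have iM := klipschitz_integrable mu_supp (ltW L0) fL.
have gL : 1.-lipschitz (fun x => L^-1 * f x)%R.
  have := klipschitzZ (L^-1)%R fL.
  by rewrite ger0_norm ?invr_ge0 ?(ltW L0)// mulVf// gt_eqF.
have := W1_test gL.
rewrite (integral_avg_emp_spec H_rand)//; last 2 first.
  exact: klipschitz_measurable gL.
  exact: avg_lipschitz gL.
have -> : \int[P]_w (mean_spec H (fun x => L^-1 * f x)%R w)%:E =
    (L^-1)%R%:E * \int[P]_w (mean_spec H f w)%:E.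
  rewrite -integralZl//; apply: eq_integral => w _.
  by rewrite /mean_spec -mulr_sumr mulrCA EFinM.
under [X in _ - X]eq_integral do rewrite EFinM.
rewrite integralZl// -muleBr//; last first.
  by rewrite fin_num_adde_defl// fin_numN integrable_fin_num.
rewrite abseM gee0_abs ?lee_fin ?invr_ge0 ?(ltW L0)//.
by rewrite muleC -lee_pdivlMr ?invr_gt0// invrK -EFinM mulrC.
Qed.

End W1Lipschitz.

(** The deviation that [assumption_L] controls, as a real number: the mean is
    finite when [f] is Lipschitz ([integrable_mean_klipschitz]). *)
Definition mean_dev d (Omega : measurableType d) (R : realType) N
    (P : probability Omega R) (H : Omega -> 'M[R]_N) (f : R -> R) w : R :=
  `|mean_spec H f w - fine (\int[P]_w (mean_spec H f w)%:E)%E|.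

Lemma measurable_mean_dev d (Omega : measurableType d) (R : realType) N
    (P : probability Omega R) (H : Omega -> 'M[R]_N) (f : R -> R) :
  random_symmx H -> measurable_fun [set: R] f ->
  measurable_fun [set: Omega] (mean_dev P H f).
Proof.
move=> H_rand mf; apply: measurableT_comp => //; apply: measurable_funB => //.
exact: measurable_mean_spec.
Qed.

Lemma lip_norm_ge (R : realType) (f : R -> R) x y : x != y ->
  ((`|f x - f y| / `|x - y|)%:E <= lip_norm f)%E.
Proof. by move=> xy; apply: ereal_sup_ubound; exists (x, y). Qed.

Section Concentration.
Context {R : realType} {d : nat -> measure_display}
  {Omega : forall N, measurableType (d N)}.
Variables (P : forall N, probability (Omega N) R)
  (H : forall N, Omega N -> 'M[R]_N).
Local Open Scope ereal_scope.

(** [assumption_L] for any Lipschitz bound [L] in place of the optimal constant.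
    If the latter is 0, [f] is constant and there is no deviation. *)
Lemma lipschitz_tail : assumption_L P H ->
  exists2 eps0 : R, (0 < eps0)%R &
  forall zeta : R, (0 < zeta)%R -> exists2 c : R, (0 < c)%R &
  forall N, (0 < N)%N -> random_symmx (@H N) ->
  forall L (f : R -> R), (0 < L)%R -> L.-lipschitz f ->
  (P N).-integrable setT (EFin \o mean_spec (@H N) f) ->
  forall delta, (0 < delta)%R -> let x := (N%:R * delta / L)%R in
  P N [set w | (delta < mean_dev (P N) (@H N) f w)%R] <=
    (expR (- (c / N%:R `^ zeta) * Num.min (x ^+ 2) (x `^ (1 + eps0))))%:E.
Proof.
move=> [eps0 eps0_gt0 HL]; exists eps0 => // zeta zeta0.
have [c c0 {}HL] := HL zeta zeta0; exists c => // N N0 H_rand L f L0 fL iF delta.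
move=> delta0; cbv zeta; set x := (N%:R * delta / L)%R.
have Nr : (N%:R != 0 :> R)%R by rewrite pnatr_eq0 -lt0n.
have lip_ge0 : 0 <= lip_norm f.
  by apply: le_trans (lip_norm_ge f (oner_neq0 R)); rewrite lee_fin divr_ge0.
have lip_le : lip_norm f <= L%:E by exact: lip_norm_le.
have lipE : (fine (lip_norm f))%:E = lip_norm f.
  by rewrite fineK// ge0_fin_numE// (le_lt_trans lip_le)// ltry.
have [l0|l0] := eqVneq (fine (lip_norm f)) 0%R.
  have f_cst y : f y = f 0%R.
    apply/eqP; rewrite -subr_eq0 -normr_le0; have [->|y0] := eqVneq y 0%R.
      by rewrite subrr normr0.
    have := lip_norm_ge f y0; rewrite -lipE l0 lee_fin subr0.
    by rewrite pmulr_lle0// invr_gt0 normr_gt0.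
  have mE w : mean_spec (@H N) f w = f 0%R.
    rewrite /mean_spec (eq_bigr (fun=> f 0%R))// sumr_const card_ord.
    by rewrite -[X in (_ * X)%R]mulr_natl mulKf.
  rewrite (_ : [set w | _] = set0); first by rewrite measure0 lee_fin expR_ge0.
  rewrite -subset0 => w /=; rewrite /mean_dev mE.
  under eq_integral do rewrite mE.
  rewrite integral_cst// [X in _ * X]probability_setT mule1 /= subrr normr0.
  by rewrite ltNge (ltW delta0).
have {}l0 : (0 < fine (lip_norm f))%R by rewrite lt_neqAle eq_sym l0 fine_ge0.
have lL : (fine (lip_norm f) <= L)%R by rewrite -lee_fin lipE.
have := HL f (klipschitz_lipschitz fL) delta delta0 N N0; cbv zeta.
set x' := (N%:R * delta / _)%R => tail.
have xx' : (x <= x')%R.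
  by rewrite ler_wpM2l ?lef_pV2// mulr_ge0// ltW.
have x0 : (0 <= x)%R by rewrite !mulr_ge0 ?invr_ge0// ltW.
apply: (@le_trans _ _ (expR (- (c / N%:R `^ zeta) *
    Num.min (x' ^+ 2) (x' `^ (1 + eps0))))%:E); last first.
  rewrite lee_fin ler_expR !mulNr lerN2 ler_wpM2l//.
    by rewrite divr_ge0 ?powR_ge0// ltW.
  have x'0 := le_trans x0 xx'.
  rewrite le_min2//; first by rewrite lerXn2r.
  by apply: ge0_ler_powR; rewrite ?nnegrE// addr_ge0// ltW.
apply: le_trans tail; rewrite le_eqVlt; apply/orP; left; apply/eqP.
congr (P N _); apply/seteqP.
have trE w : \tr (fun_mx f (@H N w)) = (N%:R * mean_spec (@H N) f w)%R.
  by rewrite mxtrace_fun_mx /mean_spec mulVKf.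
have EE : (N%:R^-1)%R%:E * 'E_(P N)[fun w' => \tr (fun_mx f (@H N w'))] =
    \int[P N]_w (mean_spec (@H N) f w)%:E.
  rewrite unlock; under eq_integral do rewrite trE EFinM.
  by rewrite integralZl// muleA -EFinM mulVf// mul1e.
have fE : (fine (\int[P N]_w (mean_spec (@H N) f w)%:E))%:E =
    \int[P N]_w (mean_spec (@H N) f w)%:E.
  by rewrite fineK//; exact: integrable_fin_num iF.
by split => w /=; rewrite /mean_dev trE EE mulKf// -fE -EFinB abse_EFin lte_fin.
Qed.

End Concentration.

Section ExpMoment.
Context d (Omega : measurableType d) (R : realType) (P : probability Omega R).
Local Open Scope ereal_scope.

(** Cut the values above [u0] into unit intervals: the one that starts at
    [u0 + k] contributes at most [exp (l (u0 + k + 1) - (l + 1) (u0 + k))], a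
    geometric term. *)
Lemma exp_moment_le (l : R) (u0 : R) (Z : Omega -> R) :
  (0 <= l)%R -> measurable_fun [set: Omega] Z ->
  (forall u, (u0 <= u)%R ->
    P [set w | (u < Z w)%R] <= (expR (- ((l + 1) * u)))%:E) ->
  \int[P]_w (expR (l * Z w))%:E <=
    (expR (l * u0) + expR l * expR (- u0) / (1 - expR (- 1)))%:E.
Proof.
move=> l0 mZ tail.
have mA u : measurable [set w | (u < Z w)%R].
  rewrite -[X in measurable X]setTI; have := mZ measurableT `]u, +oo[%classic.
  move=> /(_ (measurable_itv _)); congr (measurable (_ `&` _)).
  by apply/seteqP; split => w /=; rewrite in_itv/= andbT.
pose g k w := (expR (l * (u0 + k%:R + 1)) *
  (\1_[set w | (u0 + k%:R < Z w)%R] w : R))%:E.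
have g0 k w : 0 <= g k w by rewrite lee_fin mulr_ge0 ?expR_ge0.
have mg k : measurable_fun [set: Omega] (g k).
  by apply/measurable_EFinP/measurable_funM => //; exact: measurable_indic.
have le_g w : (expR (l * Z w))%:E <= (expR (l * u0))%:E + \sum_(k <oo) g k w.
  have [Zu|uZ] := leP (Z w) u0.
    rewrite -[leLHS]adde0 leeD//; last exact: nneseries_ge0.
    by rewrite lee_fin ler_expR ler_wpM2l.
  have exn : exists n, (Z w <= u0 + n%:R)%R.
    exists (Num.trunc (Z w - u0)).+1; rewrite -lerBlDl.
    exact/ltW/truncnS_gt.
  have [[|n] Zn nmin] := ex_minnP exn.
    by move: Zn; rewrite addr0 leNgt uZ.
  rewrite -[leLHS]add0e leeD ?lee_fin ?expR_ge0//.
  apply: (@le_trans _ _ (\sum_(0 <= k < n.+1) g k w)); last first.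
    exact: nneseries_lim_ge.
  rewrite big_nat_recr//= -[leLHS]add0e leeD ?sume_ge0//.
  rewrite /g indicE mem_set/= ?mulr1 ?lee_fin ?ler_expR ?ler_wpM2l//.
    by rewrite -addrA natr1.
  by rewrite ltNge; apply/negP => /nmin; rewrite ltnn.
apply: (@le_trans _ _ (\int[P]_w ((expR (l * u0))%:E + \sum_(k <oo) g k w))).
  apply: ge0_le_integral => //.
  - by apply/measurable_EFinP/measurableT_comp => //; exact: measurable_funM.
  - by apply: emeasurable_funD => //; exact: ge0_emeasurable_sum.
rewrite ge0_integralD//; do ?[exact: ge0_emeasurable_sum
  |by move=> w _; exact: nneseries_ge0].
rewrite integral_cst// [X in _ * X]probability_setT mule1 integral_nneseries//.
rewrite EFinD leeD2l//.
apply: (@le_trans _ _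
    (\sum_(k <oo) (expR l * expR (- u0) * expR (- 1) ^+ k)%:E)).
  apply: lee_nneseries => [k _ _|k _]; first exact: integral_ge0.
  rewrite /g; under eq_integral do rewrite EFinM.
  rewrite ge0_integralZl//;
    do ?[exact/measurable_EFinP/measurable_indic|by rewrite lee_fin expR_ge0].
  rewrite integral_indic// setIT.
  apply: (@le_trans _ _ ((expR (l * (u0 + k%:R + 1)))%:E *
      (expR (- ((l + 1) * (u0 + k%:R))))%:E)).
    by rewrite lee_wpmul2l ?lee_fin ?expR_ge0// tail// lerDl.
  rewrite -EFinM -expRD -expRM_natl -!expRD lee_fin ler_expR.
  by rewrite le_eqVlt; apply/orP; left; apply/eqP; ring.
by rewrite nneseries_geometric// ?mulr_ge0 ?expR_ge0//=.
Qed.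

End ExpMoment.

(** * Rates and test functions *)

Section Rates.
Context {R : realType}.

Lemma near_powR_gt (a C : R) : 0 < a -> \forall N \near \oo, C < N%:R `^ a.
Proof.
move=> a0; near=> N.
have : (`|C| + 1) `^ a^-1 < N%:R by near: N; exact: nbhs_infty_gtr.
have C1 : 0 < `|C| + 1 by rewrite ltr_wpDl.
move=> /(gt0_ltr_powR a0); rewrite !nnegrE powR_ge0 ler0n => /(_ isT isT).
rewrite -powRrM mulVf ?gt_eqF// powRr1 ?(ltW C1)//.
by apply: le_lt_trans; rewrite (le_trans (ler_norm C))// lerDl.
Unshelve. all: by end_near.
Qed.

Lemma near_natr_gt0 : \forall N \near \oo, (0 < N%:R :> R) && (0 < N)%N.
Proof. by near=> N; rewrite ltr0n andbb; near: N; exact: nbhs_infty_gt.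
Unshelve. all: by end_near.
Qed.

(** In the range [u >= delta * N] the concentration rate beats any multiple of
    [u]: as [p > zeta], the factor [(u / L) ^ p] absorbs [N ^ zeta]. *)
Lemma tail_rate (c zeta p L delta K : R) : 0 < c -> zeta < p -> 0 <= p ->
  0 < L -> 0 < delta ->
  \forall N \near \oo, forall u, delta * N%:R <= u ->
    K * u <= c / N%:R `^ zeta * (u / L) `^ (1 + p).
Proof.
move=> c0 zp p0 L0 d0; near=> N => u Nu.
have /andP[N0 _] : (0 < N%:R :> R) && (0 < N)%N.
  by near: N; exact: near_natr_gt0.
have dL0 : 0 < delta / L by rewrite divr_gt0.
have u0 : 0 < u by rewrite (lt_le_trans _ Nu)// mulr_gt0.
have uL0 : 0 < u / L by rewrite divr_gt0.
have KN : K / (c / L * (delta / L) `^ p) < N%:R `^ (p - zeta).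
  by near: N; apply: near_powR_gt; rewrite subr_gt0.
rewrite powRD ?(gt_eqF uL0) ?implybT// powRr1 ?(ltW uL0)//.
have h : (delta / L) `^ p * N%:R `^ p <= (u / L) `^ p.
  rewrite -powRM ?(ltW dL0) ?(ltW N0)//.
  apply: ge0_ler_powR; rewrite ?nnegrE ?(ltW uL0) ?(mulr_ge0 (ltW dL0) (ltW N0))//.
  by rewrite mulrAC ler_wpM2r ?invr_ge0 ?(ltW L0).
have cN : 0 < c / N%:R `^ zeta by rewrite divr_gt0// powR_gt0.
rewrite (@le_trans _ _ (c / N%:R `^ zeta *
  (u / L * ((delta / L) `^ p * N%:R `^ p))))//; last first.
  by rewrite ler_wpM2l ?(ltW cN)// ler_wpM2l ?(ltW uL0).
move: KN; rewrite ltr_pdivrMr; last by rewrite !mulr_gt0 ?invr_gt0 ?powR_gt0.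
rewrite powRB ?(gt_eqF N0) ?implybT//.
move: (N%:R `^ p) (N%:R `^ zeta) ((delta / L) `^ p) => X Z D KN.
rewrite (_ : c / Z * _ = u * (X / Z * (c / L * D))); last by ring.
by rewrite mulrC ler_wpM2l ?(ltW u0)// ltW.
Unshelve. all: by end_near.
Qed.

Lemma near_expR_add (eps D : R) : 0 < eps ->
  \forall N \near \oo, expR (eps / 2 * N%:R) + D <= expR (N%:R * eps).
Proof.
move=> e0; near=> N; set t := expR _.
have -> : expR (N%:R * eps) = t * t by rewrite -expRD; congr expR; field.
have e20 : 0 < eps / 2 by rewrite divr_gt0.
have t1 : `|D| + 1 <= t.
  rewrite (le_trans _ (expR_ge1Dx _))// addrC lerD2l mulrC -ler_pdivrMr//.
  by near: N; exact: nbhs_infty_ger.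
have D0 := normr_ge0 D; have DD := ler_norm D.
by nra.
Unshelve. all: by end_near.
Qed.

Lemma klipschitzB (K L : R) (f g : R -> R) : K.-lipschitz f -> L.-lipschitz g ->
  (K + L).-lipschitz (fun x => f x - g x).
Proof.
move=> /klipschitzP fK /klipschitzP gL; apply/klipschitzP => x y.
have -> : f x - g x - (f y - g y) = (f x - f y) - (g x - g y) by ring.
by rewrite mulrDl (le_trans (ler_normB _ _))// lerD.
Qed.

(** A Lipschitz function between the indicator of [[- b, b]] and twice that of
    [[- 2 b, 2 b]]. *)
Definition tent (b x : R) : R := Num.max 0 (2 - `|x| / b).

Lemma klipschitz_tent b : 0 < b -> b^-1.-lipschitz (tent b).
Proof.
move=> b0; apply/klipschitzP => x y; rewrite /tent ![Num.max 0 _]maxC.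
rewrite (le_trans (max_dist _ _ _))//.
have -> : 2 - `|x| / b - (2 - `|y| / b) = (`|y| - `|x|) / b by ring.
rewrite normrM [`|b^-1|]ger0_norm ?invr_ge0 ?(ltW b0)// mulrC.
by rewrite ler_wpM2l ?invr_ge0 ?(ltW b0)// distrC ler_dist_dist.
Qed.

Lemma tent_ge0 b x : 0 <= tent b x.
Proof. by rewrite /tent le_max lexx. Qed.

Lemma tent_ge1 b x : 0 < b -> `|x| <= b -> 1 <= tent b x.
Proof.
move=> b0 xb; rewrite /tent le_max; apply/orP; right.
have : `|x| / b <= 1 by rewrite ler_pdivrMr// mul1r.
by lra.
Qed.

Lemma tent_le b x : 0 < b -> tent b x <= 2 * \1_(sym_itv (2 * b)) x.
Proof.
move=> b0; rewrite /tent indicE; have [xb|xb] := leP `|x| (2 * b).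
  rewrite mem_set//= mulr1 ge_max ler0n/= lerBlDr lerDl divr_ge0//.
  exact: ltW.
rewrite memNset//=; last by rewrite /sym_itv/=; apply/negP; rewrite -ltNge.
by rewrite mulr0 ge_max lexx/= subr_le0 ler_pdivlMr// ltW.
Qed.

(** Where [|x| <= b], the tent subtracts at least [A] from a nonpositive value,
    which puts the left-hand side below [- A]. *)
Lemma logmax_tent_le_ln A b x : 0 <= A -> 0 < b <= 1 -> expR (- A) < `|x| ->
  logmax b x - A * tent b x <= ln `|x|.
Proof.
move=> A0 /andP[b0 b1] xA; have x0 : 0 < `|x| by rewrite (lt_trans _ xA)// expR_gt0.
rewrite /logmax; case: (leP `|x| b) => xb; last first.
  by rewrite lerBlDr lerDl mulr_ge0// tent_ge0.
have lnx : - A < ln `|x| by rewrite -[ltLHS]expRK ltr_ln ?posrE ?expR_gt0.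
rewrite (le_trans _ (ltW lnx))// lerBlDr.
have := tent_ge1 b0 xb; have : ln b <= 0 by exact: ln_le0.
by move=> lnb B1; nra.
Qed.

End Rates.

(** * Upper and lower bounds for one determinant *)

Section SingleFamily.
Context {R : realType} (kappa : R) {d : nat -> measure_display}
  {Omega : forall N, measurableType (d N)}.
Variables (P : forall N, probability (Omega N) R)
  (H : forall N, Omega N -> 'M[R]_N) (mu : nat -> probability R R).
Hypotheses (kappa_gt0 : 0 < kappa) (H_rand : forall N, random_symmx (@H N))
  (H_W : assumption_W P H kappa mu) (H_L : assumption_L P H).
Local Open Scope ereal_scope.

Definition log_potential N := fine (\int[mu N]_x lne `|x|%:E).

Lemma uniform_supp : exists M : R, forall N, (0 < N)%N ->
  mu N [set x | (M < `|x|)%R] = 0.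
Proof.
case: H_W => _ [K cK muK] _.
have [M [_ MK]] := compact_bounded cK.
exists (M + 1)%R => N N0; apply/eqP; rewrite -measure_le0 -(muK N N0).
apply: le_measure; rewrite ?inE.
- by rewrite -setC_sym_itv; apply: measurableC; exact: measurable_sym_itv.
- by apply: measurableC; exact: compact_measurable.
move=> x /=; rewrite ltNge => /negP; apply: contra_not => Kx.
by apply: (MK (M + 1)%R _ x Kx); rewrite ltrDl.
Qed.

Lemma log_potentialE N : (0 < N)%N ->
  \int[mu N]_x lne `|x|%:E = (log_potential N)%:E.
Proof.
move=> N0; have [M muM] := uniform_supp.
case: H_W => _ _ /(_ N N0) mud.
have k2 : (0 < kappa / 2 < kappa)%R.
  by rewrite divr_gt0//= ltr_pdivrMr// ltr_pMr// ltr1n.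
have [fI _ _] := integral_logmax kappa_gt0 mud (muM N N0) k2.
by rewrite /log_potential fineK.
Qed.

Lemma potential_cst_ge0 : (0 <= potential_cst kappa)%R.
Proof.
have z1 : (0 <= 1 - expR (- kappa))%R.
  by rewrite subr_ge0 -expR0 ler_expR oppr_le0 ltW.
by rewrite /potential_cst /density_cst !mulr_ge0 ?invr_ge0 ?expR_ge0// ltW.
Qed.

Lemma mean_vs_mu L (f : R -> R) N (N0 : (0 < N)%N) : (0 < L)%R ->
  L.-lipschitz f ->
  (`|fine (\int[P N]_w (mean_spec (@H N) f w)%:E)
     - fine (\int[mu N]_x (f x)%:E)| <= L * N%:R `^ (- kappa))%R.
Proof.
move=> L0 fL; have [M muM] := uniform_supp; case: H_W => /(_ N N0) W1N _ _.
have iP := integrable_mean_klipschitz (H_rand N) (muM N N0) W1N fL.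
have iM := klipschitz_integrable (muM N N0) (ltW L0) fL.
have := W1_klipschitz (H_rand N) (muM N N0) W1N L0 fL.
rewrite -(fineK (integrable_fin_num measurableT iP)).
rewrite -(fineK (integrable_fin_num measurableT iM)).
by rewrite -EFinB abse_EFin lee_fin.
Qed.

Lemma mean_integrable L (f : R -> R) N (N0 : (0 < N)%N) : L.-lipschitz f ->
  (P N).-integrable setT (EFin \o mean_spec (@H N) f).
Proof.
move=> fL; have [M muM] := uniform_supp; case: H_W => /(_ N N0) W1N _ _.
exact (integrable_mean_klipschitz (H_rand N) (muM N N0) W1N fL).
Qed.

Lemma sum_eigval_mean N (f : R -> R) (w : Omega N) : (0 < N)%N ->
  (\sum_(j < N) f (eigval (H w) j) = N%:R * mean_spec (@H N) f w)%R.
Proof.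
by move=> N0; rewrite /mean_spec mulVKf// pnatr_eq0 -lt0n.
Qed.

(** The exponent [zeta] is half of [min(1, eps0)], so that both branches of the
    minimum in [assumption_L] fall under [tail_rate]; [delta] is such that
    [exp (l delta N)], the contribution of the deviations below [delta N], is at
    most [exp (eps N / 2)]. *)
Lemma mean_dev_moment (eta l eps : R) : (0 < eta)%R -> (0 <= l)%R ->
  (0 < eps)%R -> \forall N \near \oo,
  \int[P N]_w (expR (l * (N%:R * mean_dev (P N) (@H N) (logmax eta) w)))%:E
    <= (expR (N%:R * eps))%:E.
Proof.
move=> eta0 l0 e0.
have [eps0 eps0_gt0 tail] := lipschitz_tail H_L.
pose p := Num.min 1%R eps0.
have p0 : (0 < p)%R by rewrite lt_min ltr01.
have p20 : (0 < p / 2)%R by rewrite divr_gt0.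
have p2p : (p / 2 < p)%R by rewrite ltr_pdivrMr// ltr_pMr// ltr1n.
have [c c0 {}tail] := tail (p / 2)%R p20.
pose delta := (eps / 2 / (l + 1))%R.
have l1 : (0 < l + 1)%R by rewrite ltr_wpDl.
have d0 : (0 < delta)%R by rewrite !divr_gt0.
have etaV : (0 < eta^-1)%R by rewrite invr_gt0.
have p1 : (p / 2 < 1)%R by rewrite (lt_le_trans p2p)// ge_min lexx.
have pe : (p / 2 < eps0)%R by rewrite (lt_le_trans p2p)// ge_min lexx orbT.
near=> N.
have /andP[N0 N1] : (0 < N%:R :> R)%R && (0 < N)%N.
  by near: N; exact: near_natr_gt0.
have tail1 : forall u, (delta * N%:R <= u)%R -> ((l + 1) * u <=
    c / N%:R `^ (p / 2) * (u / eta^-1) `^ (1 + 1))%R.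
  by near: N; exact: tail_rate.
have tail2 : forall u, (delta * N%:R <= u)%R -> ((l + 1) * u <=
    c / N%:R `^ (p / 2) * (u / eta^-1) `^ (1 + eps0))%R.
  by near: N; apply: tail_rate => //; exact: ltW.
have fL := klipschitz_logmax eta0.
apply: (@le_trans _ _ (expR (l * (delta * N%:R)) +
    expR l * expR (- (delta * N%:R)) / (1 - expR (- 1)))%:E).
  apply: exp_moment_le => //.
    apply: measurable_funM => //; apply: measurable_mean_dev => //.
    exact: klipschitz_measurable fL.
  move=> u Nu; have u0 : (0 < u)%R by rewrite (lt_le_trans _ Nu)// mulr_gt0.
  have uN : (0 < u / N%:R)%R by rewrite divr_gt0.
  have := tail N N1 (H_rand N) _ _ etaV fL (mean_integrable N1 fL) _ uN.
  cbv zeta; rewrite mulrCA divff ?gt_eqF// mulr1 => tailN.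
  rewrite (_ : [set w | _] = [set w | (u / N%:R <
      mean_dev (P N) (@H N) (logmax eta) w)%R]); last first.
    by apply/seteqP; split => w /=; rewrite ltr_pdivrMr// mulrC.
  rewrite (le_trans tailN)// lee_fin ler_expR mulNr lerN2.
  have uL : (0 <= u / eta^-1)%R by rewrite divr_ge0// ltW.
  rewrite minEle; case: ifPn => _; last exact: tail2.
  by rewrite -powR_mulrn//; exact: tail1.
apply: (@le_trans _ _ (expR (eps / 2 * N%:R) +
    expR l / (1 - expR (- 1)))%:E); last first.
  rewrite lee_fin; near: N; exact: near_expR_add.
have e1 : (0 < 1 - expR (- 1) :> R)%R.
  by rewrite subr_gt0 -expR0 ltr_expR oppr_lt0.
rewrite lee_fin lerD//.
  rewrite ler_expR mulrA ler_wpM2r//.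
  rewrite /delta mulrCA ger_pMr ?divr_gt0//.
  by rewrite ler_pdivrMr// mul1r lerDl.
rewrite ler_wpM2r ?invr_ge0 ?(ltW e1)// ger_pMr ?expR_gt0//.
by rewrite -expR0 ler_expR oppr_le0 mulr_ge0// ltW.
Unshelve. all: by end_near.
Qed.

(** [Y] is the deviation of the mean of [logmax eta], where [eta] is such that the
    truncation of the logarithm costs at most [eps / 2]; the other half of [eps]
    pays for the distance [W1]. *)
Lemma det_upper (l eps : R) : (0 <= l)%R -> (0 < eps)%R ->
  \forall N \near \oo, exists Y : Omega N -> R,
  [/\ measurable_fun setT Y, forall w, (0 <= Y w)%R,
      forall w, (`|\det (H w)| <= expR (N%:R * (log_potential N + eps + Y w)))%R &
      \int[P N]_w (expR (l * (N%:R * Y w)))%:E <= (expR (N%:R * eps))%:E].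
Proof.
move=> l0 e0.
pose C := (eps / 2 / (potential_cst kappa + 1))%R.
have pc1 : (0 < potential_cst kappa + 1)%R.
  by rewrite ltr_wpDl// potential_cst_ge0.
have C0 : (0 < C)%R by rewrite !divr_gt0.
pose eta := Num.min (kappa / 2)%R (C `^ kappa^-1)%R.
have eta0 : (0 < eta)%R by rewrite lt_min divr_gt0//= powR_gt0.
have etak : (0 < eta < kappa)%R.
  rewrite eta0/= gt_min; apply/orP; left.
  by rewrite ltr_pdivrMr// ltr_pMr// ltr1n.
have etaC : (potential_cst kappa * eta `^ kappa <= eps / 2)%R.
  rewrite (@le_trans _ _ (potential_cst kappa * C)%R)//.
    rewrite ler_wpM2l ?potential_cst_ge0//.
    rewrite (@le_trans _ _ ((C `^ kappa^-1) `^ kappa)%R)//.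
      apply: ge0_ler_powR; rewrite ?nnegrE ?powR_ge0 ?(ltW kappa_gt0) ?(ltW eta0)//.
      by rewrite ge_min lexx orbT.
    by rewrite -powRrM mulVf ?gt_eqF// powRr1// ltW.
  rewrite /C mulrCA ger_pMr ?divr_gt0// ler_pdivrMr// mul1r.
  by rewrite lerDl.
have [M muM] := uniform_supp.
near=> N.
have /andP[N0 N1] : (0 < N%:R :> R)%R && (0 < N)%N.
  by near: N; exact: near_natr_gt0.
have fL := klipschitz_logmax eta0.
have etaV : (0 < eta^-1)%R by rewrite invr_gt0.
have LN : (eta^-1 * N%:R `^ (- kappa) <= eps / 2)%R.
  rewrite powRN ler_pdivrMr ?powR_gt0// mulrC -ler_pdivrMr ?divr_gt0//.
  by apply/ltW; near: N; exact: near_powR_gt.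
exists (mean_dev (P N) (@H N) (logmax eta)); split.
- by apply: measurable_mean_dev => //; exact: klipschitz_measurable fL.
- by move=> w; exact: normr_ge0.
- move=> w; have [_ symH] := H_rand N.
  rewrite norm_det_eigval//.
  apply: (@le_trans _ _ (\prod_(j < N) expR (logmax eta (eigval (H w) j)))%R).
    apply: ler_prod => j _; rewrite normr_ge0/= /logmax lnK.
      by rewrite le_max lexx.
    by rewrite posrE lt_max eta0 orbT.
  rewrite -expR_sum sum_eigval_mean// ler_expR ler_wpM2l ?(ltW N0)//.
  rewrite -lerBlDr; set m := fine (\int[P N]_w' (mean_spec (@H N) (logmax eta) w')%:E).
  apply: (@le_trans _ _ m).
    by rewrite lerBlDr -lerBlDl (le_trans (ler_norm _)).
  have := mean_vs_mu N1 etaV fL; rewrite -/m => /(le_trans (ler_norm _)).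
  rewrite lerBlDr => /le_trans; apply.
  case: H_W => _ _ /(_ N N1) mud.
  have [_ _] := integral_logmax kappa_gt0 mud (muM N N1) etak.
  have iM := klipschitz_integrable (muM N N1) (ltW etaV) fL.
  rewrite log_potentialE// -(fineK (integrable_fin_num measurableT iM)).
  by rewrite -EFinD lee_fin => h; lra.
- near: N; exact: mean_dev_moment.
Unshelve. all: by end_near.
Qed.

End SingleFamily.

Section Lower.
Context {R : realType} (kappa : R) {d : nat -> measure_display}
  {Omega : forall N, measurableType (d N)}.
Variables (P : forall N, probability (Omega N) R)
  (H : forall N, Omega N -> 'M[R]_N) (mu : nat -> probability R R).
Hypotheses (kappa_gt0 : 0 < kappa) (H_rand : forall N, random_symmx (@H N))
  (H_W : assumption_W P H kappa mu) (H_L : assumption_L P H)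
  (H_Gap : assumption_Gap P H).
Local Open Scope ereal_scope.

(** This form makes the gap event measurable, by [measurable_emp_spec_ev]. *)
Lemma gap_setE N (r : R) : (0 < N)%N ->
  [set w | forall x, eigenvalue (H w) x -> x \notin `[- r, r]%R] =
  (fun w : Omega N => emp_spec (H w) `[(- r)%R, r]%classic) @^-1` [set 0].
Proof.
move=> N0; have [_ symH] := H_rand N.
have V0 : (0 < N%:R^-1 :> R)%R by rewrite invr_gt0 ltr0n.
apply/seteqP; split => w /=.
  move=> gap; rewrite /emp_spec big1 ?mule0// => j _.
  rewrite diracE mem_setE (negbTE (gap _ _))//.
  by apply/eigenvalue_eigval => //; exists j.
move=> /eqP; rewrite /emp_spec mule_eq0 eqe gt_eqF//= => emp0 x.
move=> /eigenvalue_eigval[//|j <-]; apply/negP => jr.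
move: emp0; rewrite (bigD1 j)//= diracE mem_setE jr.
by rewrite padde_eq0 ?sume_ge0// onee_eq0.
Qed.

Lemma measurable_gap N (r : R) : (0 < N)%N ->
  measurable [set w : Omega N | forall x, eigenvalue (H w) x ->
    x \notin `[- r, r]%R].
Proof.
move=> N0; rewrite gap_setE// -[X in measurable X]setTI.
apply: measurable_emp_spec_ev => //; exact: emeasurable_set1.
Qed.

Lemma near_gap (a delta : R) : (0 < a)%R -> (0 < delta)%R ->
  \forall N \near \oo,
  P N (~` [set w | forall x, eigenvalue (H w) x ->
    x \notin `[- expR (- (N%:R `^ a)), expR (- (N%:R `^ a))]%R]) <= delta%:E.
Proof.
move=> a0 d0; have /fine_cvgP[_ /cvgrPdist_le/(_ _ d0) gap1] := H_Gap a0.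
apply: filterS2 (near_natr_gt0 (R := R)) gap1 => N /andP[_ N1] /=.
set G := [set w | _] => gN.
have mG : measurable G by exact: measurable_gap.
have PG : P N G \is a fin_num by exact: fin_num_measure.
move: gN => /(le_trans (ler_norm _)); rewrite -lee_fin EFinB fineK//.
by rewrite probability_setC.
Qed.

Lemma integral_logmax_tent N A b : (0 < N)%N -> (0 <= A)%R ->
  (0 < b)%R -> (2 * b < kappa)%R ->
  (log_potential mu N - A * (2 * (density_cst kappa * (2 * b) `^ kappa)) <=
   fine (\int[mu N]_x (logmax b x - A * tent b x)%:E))%R.
Proof.
move=> N0 A0 b0 bk; have [M muM] := uniform_supp H_W.
case: (H_W) => _ _ /(_ N N0) mud.
have bk' : (0 < b < kappa)%R.
  by rewrite b0 (lt_trans _ bk)// ltr_pMl// ltr1n.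
have bV : (0 <= b^-1)%R by rewrite invr_ge0 ltW.
have i1 := klipschitz_integrable (muM N N0) bV (klipschitz_logmax b0).
have i2 := klipschitz_integrable (muM N N0) bV (klipschitz_tent b0).
have i3 : (mu N).-integrable setT (EFin \o (fun x => A * tent b x)%R).
  exact: integrableZl i2.
have mS : measurable (sym_itv (2 * b)%R) by exact: measurable_sym_itv.
have h1 : \int[mu N]_x (tent b x)%:E <=
    (2 * (density_cst kappa * (2 * b) `^ kappa))%:E.
  apply: (@le_trans _ _ (\int[mu N]_x (2 * \1_(sym_itv (2 * b)) x)%:E)).
    apply: ge0_le_integral => //.
    - by move=> x _; rewrite lee_fin tent_ge0.
    - by apply/measurable_EFinP; exact: klipschitz_measurable (klipschitz_tent b0).
    - by apply/measurable_EFinP/measurable_funM => //; exact: measurable_indic.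
    - by move=> x _; rewrite lee_fin tent_le.
  under eq_integral do rewrite EFinM.
  rewrite ge0_integralZl//; last exact/measurable_EFinP/measurable_indic.
  rewrite integral_indic// setIT EFinM lee_wpmul2l//.
  by apply: density_sym_itv => //; rewrite mulr_gt0.
under eq_integral do rewrite EFinB.
rewrite (integralB_EFin measurableT i1 i3).
under [X in _ - X]eq_integral do rewrite EFinM.
rewrite integralZl//.
have [_ h2 _] := integral_logmax kappa_gt0 mud (muM N N0) bk'.
move: h1 h2; rewrite (log_potentialE kappa_gt0 H_W N0).
rewrite -(fineK (integrable_fin_num measurableT i1)).
rewrite -(fineK (integrable_fin_num measurableT i2)).
rewrite !lee_fin => h1 h2; rewrite -EFinM -EFinB /= lerB//.
exact: ler_wpM2l.
Qed.

(** On the intersection [G] of the gap event and of the event that the mean of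
    [f = logmax b - A * tent b] deviates by at most [eps / 3], that mean bounds
    [ln |det| / N] from below; the other two thirds of [eps] pay for the distance
    [W1] and for the integral of [A * tent b] against [mu N]. *)
Lemma det_lower (eps delta : R) : (0 < eps)%R -> (0 < delta)%R ->
  \forall N \near \oo, exists G : set (Omega N),
  [/\ measurable G, P N (~` G) <= delta%:E &
      forall w, G w ->
        (expR (N%:R * (log_potential mu N - eps)) <= `|\det (H w)|)%R].
Proof.
move=> e0 d0.
pose q := Num.min kappa 1%R.
have q0 : (0 < q)%R by rewrite lt_min kappa_gt0 ltr01.
have q1 : (q <= 1)%R by rewrite ge_min lexx orbT.
have qk : (q <= kappa)%R by rewrite ge_min lexx.
(* The rates below vanish because of a < beta * kappa (integral of the tent),
   a + beta < kappa (distance W1) and a + beta + 1/4 < 1 (concentration, with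
   zeta = 1/4). *)
pose beta := (q / 4)%R.
pose a := (q * q / 8)%R.
have qq : (q * q <= q)%R by rewrite ger_pMr.
have qq0 : (0 < q * q)%R by rewrite mulr_gt0.
have a0 : (0 < a)%R by rewrite divr_gt0.
have b0 : (0 < beta)%R by rewrite divr_gt0.
have bka : (0 < beta * kappa - a)%R.
  have : (q * q <= q * kappa)%R by rewrite ler_wpM2l// ltW.
  by rewrite /beta /a; lra.
have kab : (0 < kappa - a - beta)%R by rewrite /beta /a; lra.
have ab1 : (0 < 1 - beta - a)%R by rewrite /beta /a; lra.
have ab2 : (0 < 1 - beta - a - 4^-1)%R by rewrite /beta /a; lra.
have [eps0 eps0_gt0 tail] := lipschitz_tail H_L.
have [|c c0 {}tail] := tail 4^-1%R; first by rewrite invr_gt0.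
have e30 : (0 < eps / 3)%R by rewrite divr_gt0.
have d20 : (0 < delta / 2)%R by rewrite divr_gt0.
have c'0 : (0 < c * (eps / 3 / 2))%R by rewrite mulr_gt0// divr_gt0.
pose D := (density_cst kappa * 2 `^ kappa * 2)%R.
near=> N.
have /andP[N0 N1] : (0 < N%:R :> R)%R && (0 < N)%N.
  by near: N; exact: near_natr_gt0.
have Nn : (N%:R != 0 :> R)%R by rewrite gt_eqF.
pose A := (N%:R `^ a)%R; pose b := (N%:R `^ (- beta))%R.
have A0 : (0 < A)%R by rewrite powR_gt0.
have A1 : (1 < A)%R by rewrite /A; near: N; exact: near_powR_gt.
have bN0 : (0 < b)%R by rewrite powR_gt0.
have b1 : (b <= 1)%R.
  rewrite /b powRN invf_le1 ?powR_gt0//.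
  by apply/ltW; near: N; exact: near_powR_gt.
have bk : (2 * b < kappa)%R.
  rewrite /b powRN ltr_pdivrMr ?powR_gt0// mulrC -ltr_pdivrMr//.
  by near: N; exact: near_powR_gt.
pose f x := (logmax b x - A * tent b x)%R.
pose L := (b^-1 + `|A| * b^-1)%R.
have fL : L.-lipschitz f.
  apply: klipschitzB; first exact: klipschitz_logmax.
  exact: klipschitzZ (klipschitz_tent bN0).
have bV : (0 < b^-1)%R by rewrite invr_gt0.
have L0 : (0 < L)%R by rewrite ltr_pwDl// mulr_ge0// ltW.
have LE : (L <= 2 * N%:R `^ (a + beta))%R.
  have -> : (N%:R `^ (a + beta) = A * b^-1)%R.
    by rewrite /b -powRN opprK powRD// Nn implybT.
  by rewrite /L ger0_norm ?(ltW A0)//; nra.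
have L1 : (L * N%:R `^ (- kappa) <= eps / 3)%R.
  rewrite (@le_trans _ _ (2 * N%:R `^ (a + beta) * N%:R `^ (- kappa))%R)//.
    by rewrite ler_wpM2r// powR_ge0.
  rewrite -mulrA -powRD ?Nn ?implybT//.
  rewrite (_ : a + beta - kappa = - (kappa - a - beta))%R; last by ring.
  rewrite powRN ler_pdivrMr ?powR_gt0// mulrC -ler_pdivrMr//.
  by apply/ltW; near: N; exact: near_powR_gt.
have L2 : (A * (2 * (density_cst kappa * (2 * b) `^ kappa)) <= eps / 3)%R.
  have -> : (A * (2 * (density_cst kappa * (2 * b) `^ kappa)) =
      D * N%:R `^ (- (beta * kappa - a)))%R.
    rewrite powRM ?(ltW bN0)// /b -powRrM opprB addrC mulNr.
    by rewrite powRD ?Nn ?implybT// /D /A; ring.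
  rewrite powRN ler_pdivrMr ?powR_gt0// mulrC -ler_pdivrMr//.
  by apply/ltW; near: N; exact: near_powR_gt.
pose G1 := [set w : Omega N | forall x, eigenvalue (H w) x ->
  x \notin `[- expR (- A), expR (- A)]%R].
pose G2 := [set w : Omega N | (mean_dev (P N) (@H N) f w <= eps / 3)%R].
have mG1 : measurable G1 by exact: measurable_gap.
have mf : measurable_fun [set: R] f by exact: klipschitz_measurable fL.
have mG2 : measurable G2.
  have := measurable_mean_dev (P N) (H_rand N) mf.
  move=> /(_ measurableT `]-oo, (eps / 3)%R]%classic (measurable_itv _)).
  by congr (measurable _); apply/seteqP; split => w /=; rewrite in_itv/=;
    [case|split].
have G2C : ~` G2 = [set w | (eps / 3 < mean_dev (P N) (@H N) f w)%R].
  by apply/seteqP; split => w; rewrite /G2/= ltNge => /negP.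
have PG1 : P N (~` G1) <= (delta / 2)%:E.
  by rewrite /G1 /A; near: N; exact: near_gap.
have PG2 : P N (~` G2) <= (delta / 2)%:E.
  have iF := mean_integrable H_rand H_W N1 fL.
  have := tail N N1 (H_rand N) _ _ L0 fL iF _ e30; cbv zeta.
  set x := (N%:R * (eps / 3) / L)%R; rewrite G2C => /le_trans; apply.
  have xE : (eps / 3 / 2 * N%:R `^ (1 - beta - a) <= x)%R.
    have -> : (N%:R `^ (1 - beta - a) = N%:R / N%:R `^ (a + beta))%R.
      by rewrite -{2}(powRr1 (ltW N0)) -powRB ?Nn ?implybT//; congr (_ `^ _)%R; ring.
    rewrite /x ler_pdivlMr// (@le_trans _ _ (eps / 3 / 2 *
      (N%:R / N%:R `^ (a + beta)) * (2 * N%:R `^ (a + beta)))%R)//.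
      by rewrite ler_wpM2l// !mulr_ge0 ?invr_ge0 ?powR_ge0// ltW.
    rewrite le_eqVlt; apply/orP; left; apply/eqP; field.
    by rewrite gt_eqF// powR_gt0.
  have x1 : (1 <= x)%R.
    rewrite (le_trans _ xE)// mulrC -ler_pdivrMr ?divr_gt0//.
    by apply/ltW; near: N; exact: near_powR_gt.
  have xmin : (x <= Num.min (x ^+ 2) (x `^ (1 + eps0)))%R.
    rewrite le_min; apply/andP; split.
      by rewrite expr2 ler_peMr// (le_trans ler01).
    rewrite -{1}(powRr1 (le_trans ler01 x1)) ler_powR//.
    by rewrite lerDl ltW.
  rewrite lee_fin -[leRHS]lnK ?posrE// ler_expR mulNr lerNl.
  apply: (@le_trans _ _ (c / N%:R `^ 4^-1 * x)%R); last first.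
    by rewrite ler_wpM2l// divr_ge0 ?powR_ge0// ltW.
  apply: (@le_trans _ _ (c / N%:R `^ 4^-1 *
      (eps / 3 / 2 * N%:R `^ (1 - beta - a)))%R); last first.
    by rewrite ler_wpM2l// divr_ge0 ?powR_ge0// ltW.
  have -> : (c / N%:R `^ 4^-1 * (eps / 3 / 2 * N%:R `^ (1 - beta - a)) =
      N%:R `^ (1 - beta - a - 4^-1) * (c * (eps / 3 / 2)))%R.
    by rewrite [in RHS]powRB ?Nn ?implybT//; ring.
  rewrite -ler_pdivrMr//.
  by apply/ltW; near: N; exact: near_powR_gt.
exists (G1 `&` G2); split; first exact: measurableI.
  rewrite setCI; apply: (le_trans (measureU2 (P N) _ _)).
  - exact: measurableC.
  - exact: measurableC.
  by rewrite [in leRHS](splitr delta) EFinD leeD.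
move=> w [g1 g2]; have [_ symH] := H_rand N.
have lam j : (expR (- A) < `|eigval (H w) j|)%R.
  rewrite ltNge; apply/negP => jA.
  have : eigenvalue (H w) (eigval (H w) j).
    by apply/eigenvalue_eigval => //; exists j.
  by move=> /g1; rewrite in_itv/= -ler_norml jA.
rewrite norm_det_eigval//.
apply: (@le_trans _ _ (\prod_(j < N) expR (f (eigval (H w) j)))%R); last first.
  apply: ler_prod => j _; rewrite expR_ge0/=.
  have l0 : (0 < `|eigval (H w) j|)%R by rewrite (lt_trans _ (lam j))// expR_gt0.
  rewrite -[leRHS]lnK ?posrE// ler_expR.
  by apply: logmax_tent_le_ln => //; [exact: ltW|rewrite bN0].
rewrite -expR_sum sum_eigval_mean// ler_expR ler_wpM2l ?(ltW N0)//.
have := mean_vs_mu H_rand H_W N1 L0 fL.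
have := integral_logmax_tent N1 (ltW A0) bN0 bk.
move: g2; rewrite /G2/= /mean_dev; rewrite -/f.
move: (fine (\int[P N]_w _)) (fine (\int[mu N]_x _)) (mean_spec _ _ _) => m i X.
rewrite !ler_norml => /andP[g2 _] hb /andP[hm _].
by lra.
Unshelve. all: by end_near.
Qed.

End Lower.

(** * Products of determinants *)

(** The sum is at most [l] times its largest term. *)
Lemma expR_sum_le (R : realType) (l : nat) (x : 'I_l -> R) :
  expR (\sum_(i < l) x i) <= 1 + \sum_(i < l) expR (l%:R * x i).
Proof.
have [l0|l0] := posnP l.
  by subst l; rewrite !big_ord0 expR0 addr0.
have [i xi] : exists i, \sum_(j < l) x j <= l%:R * x i.
  apply/not_existsP => h.
  have : \sum_(i < l) l%:R * x i < \sum_(i < l) \sum_(j < l) x j.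
    apply: ltr_sum; first by apply/hasP; exists (Ordinal l0); rewrite ?mem_index_enum.
    by move=> i _; rewrite ltNge; apply/negP/h.
  by rewrite -mulr_sumr sumr_const card_ord mulr_natl ltxx.
rewrite [X in _ <= _ + X](bigD1 i)//= addrCA; apply: (@le_trans _ _ (expR (l%:R * x i))).
  by rewrite ler_expR.
by rewrite lerDl addr_ge0// sumr_ge0// => j _; exact: expR_ge0.
Qed.

Section Product.
Context {R : realType} (l : nat) {d : measure_display} {Omega : measurableType d}
  (P : probability Omega R) (X : 'I_l -> Omega -> R) (n e : R) (I : 'I_l -> R).
Hypotheses (mX : forall i, measurable_fun setT (X i))
  (X0 : forall i w, 0 <= X i w).
Local Open Scope ereal_scope.

Let mprod : measurable_fun [set: Omega] (fun w => (\prod_(i < l) X i w)%:E).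
Proof. by apply/measurable_EFinP/measurable_prod => i _. Qed.

(** The factors may depend on each other; [expR_sum_le] bounds the product of
    their fluctuations by a sum. *)
Lemma integral_prod_le (Y : 'I_l -> Omega -> R) :
  (forall i, measurable_fun setT (Y i)) ->
  (forall i w, (X i w <= expR (n * (I i + e + Y i w)))%R) ->
  (forall i, \int[P]_w (expR (l%:R * (n * Y i w)))%:E <= (expR (n * e))%:E) ->
  \int[P]_w (\prod_(i < l) X i w)%:E <=
  (expR (n * (\sum_(i < l) I i + l%:R * e)) * (1 + l%:R * expR (n * e)))%:E.
Proof.
move=> mY XY EY; set K := expR _.
have mE i : measurable_fun [set: Omega] (fun w => (expR (l%:R * (n * Y i w)))%:E).
  apply/measurable_EFinP/measurableT_comp => //.
  by apply: measurable_funM => //; exact: measurable_funM.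
have E0 i w : 0 <= (expR (l%:R * (n * Y i w)))%:E by rewrite lee_fin expR_ge0.
apply: (@le_trans _ _ (\int[P]_w (K%:E *
    (1 + \sum_(i < l) (expR (l%:R * (n * Y i w)))%:E)))).
  apply: ge0_le_integral => //.
  - by move=> w _; rewrite lee_fin prodr_ge0.
  - by apply: measurable_funeM; apply: emeasurable_funD => //; exact: emeasurable_sum.
  move=> w _; rewrite sumEFin -EFinD -EFinM lee_fin.
  rewrite (@le_trans _ _ (\prod_(i < l) expR (n * (I i + e + Y i w)))%R)//.
    by apply: ler_prod => i _; rewrite X0 XY.
  rewrite -expR_sum -mulr_sumr !big_split/= mulrDr expRD.
  rewrite sumr_const card_ord -[(e *+ l)%R]mulr_natl.
  by rewrite ler_wpM2l ?expR_ge0// mulr_sumr expR_sum_le.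
rewrite ge0_integralZl//; last 3 first.
- by apply: emeasurable_funD => //; exact: emeasurable_sum.
- by move=> w _; rewrite adde_ge0// sume_ge0.
- by rewrite lee_fin expR_ge0.
rewrite EFinM lee_wpmul2l ?lee_fin ?expR_ge0//.
rewrite ge0_integralD//; last 2 first.
- by move=> w _; exact: sume_ge0.
- exact: emeasurable_sum.
rewrite integral_cst// [X in _ * X]probability_setT mule1 EFinD leeD2l//.
rewrite ge0_integral_sum//.
apply: (@le_trans _ _ (\sum_(i < l) (expR (n * e))%:E)); first exact: lee_sum.
by rewrite sumEFin sumr_const card_ord mulr_natl.
Qed.

(** Restrict the integral to the intersection of the events [G i]. *)
Lemma integral_prod_ge (G : 'I_l -> set Omega) (delta : R) :
  (forall i, measurable (G i)) -> (forall i, P (~` G i) <= delta%:E) ->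
  (forall i w, G i w -> (expR (n * (I i - e)) <= X i w)%R) ->
  (expR (n * (\sum_(i < l) I i - l%:R * e)) * (1 - l%:R * delta))%:E <=
  \int[P]_w (\prod_(i < l) X i w)%:E.
Proof.
move=> mG PG GX; set K := expR _.
pose B := \big[setU/set0]_(i < l) ~` G i.
have mB : measurable B by apply: bigsetU_measurable => i _; exact: measurableC.
have PB : P B <= (l%:R * delta)%:E.
  suff : forall s : seq 'I_l, P (\big[setU/set0]_(i <- s) ~` G i) <=
      ((size s)%:R * delta)%:E.
    move=> /(_ (index_enum 'I_l)).
    by rewrite -[size _]sum1_size sum_nat_const card_ord muln1.
  elim=> [|i s ih]; first by rewrite big_nil measure0 mul0r.
  rewrite big_cons /= -natr1 addrC mulrDl mul1r EFinD.
  apply: le_trans (measureU2 P _ _) _.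
  - exact: measurableC.
  - by apply: bigsetU_measurable => j _; exact: measurableC.
  apply: leeD => //; exact: PG.
have GB i w : (~` B) w -> G i w.
  move=> Bw; apply: contrapT => Gw; apply: Bw.
  by rewrite /B (bigD1 i)//=; left.
apply: (@le_trans _ _ (\int[P]_w (K * \1_(~` B) w)%:E)).
  under eq_integral do rewrite EFinM.
  rewrite ge0_integralZl//; do ?[
    by apply/measurable_EFinP/measurable_indic; exact: measurableC
    |by rewrite lee_fin expR_ge0].
  rewrite integral_indic//; last exact: measurableC.
  rewrite setIT EFinM lee_wpmul2l ?lee_fin ?expR_ge0//.
  by rewrite [leRHS]probability_setC// EFinB leeB.
apply: ge0_le_integral => //.
- by move=> w _; rewrite lee_fin mulr_ge0 ?expR_ge0.
- apply/measurable_EFinP/measurable_funM => //.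
  by apply: measurable_indic; exact: measurableC.
move=> w _; rewrite lee_fin indicE.
case: (boolP (w \in _)) => [/[!inE] Bw|_]; last by rewrite mulr0 prodr_ge0.
rewrite mulr1 (@le_trans _ _ (\prod_(i < l) expR (n * (I i - e)))%R)//; last first.
  by apply: ler_prod => i _; rewrite expR_ge0 GX//; exact: GB.
rewrite -expR_sum -mulr_sumr sumrB sumr_const card_ord.
by rewrite -[(e *+ l)%R]mulr_natl.
Qed.

End Product.

Theorem theoremA2 (R : realType) (l : nat) (kappa : R) (kappa_gt0 : 0 < kappa)
    (d : nat -> measure_display) (Omega : forall N, measurableType (d N))
    (P : forall N, probability (Omega N) R)
    (H : forall (i : 'I_l) (N : nat), Omega N -> 'M[R]_N)
    (mu : 'I_l -> nat -> probability R R)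
    (H_rand : forall i N, random_symmx (H i N))
    (H_W : forall i, assumption_W P (H i) kappa (mu i))
    (H_L : forall i, assumption_L P (H i))
    (H_Gap : forall i, assumption_Gap P (H i)) :
  ((N%:R^-1)%:E * lne 'E_(P N)[fun w => (\prod_(i < l) `|\det (H i N w)|)%R]
     - \sum_(i < l) \int[mu i N]_x lne `|x|%:E)%E
    @[N --> \oo] --> 0%E.
Proof.
pose S N := \sum_(i < l) log_potential (mu i) N.
set T := (fun N : nat => _).
suff TE eps : 0 < eps -> \forall N \near \oo, exists2 t, T N = t%:E & `|t| <= eps.
  apply/fine_cvgP; split.
    by apply: filterS (TE _ ltr01) => N [t ->].
  apply/cvgrPdist_le => eps eps0; apply: filterS (TE _ eps0) => N [t Tt teps].
  by rewrite /= Tt sub0r normrN.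
move=> eps0.
pose X i N w := `|\det (H i N w)|.
have mX i N : measurable_fun [set: Omega N] (X i N).
  by apply: measurableT_comp => //; apply: measurable_det; case: (H_rand i N).
have X0 i N w : 0 <= X i N w by exact: normr_ge0.
pose e := eps / l.+2%:R.
have e0 : 0 < e by rewrite divr_gt0.
have eE : (l%:R + 2) * e = eps by rewrite -natrD addn2 /e mulrCA divff ?mulr1.
pose delta : R := (2 * l.+1%:R)^-1.
have delta0 : 0 < delta by rewrite invr_gt0 mulr_gt0.
(* [delta] makes the [l] good events of the lower bound occur together with
   probability at least one half. *)
have ldelta : 2^-1 <= 1 - l%:R * delta.
  have aux (y : R) : y <= 1 -> 2^-1 <= 1 - 2^-1 * y by move=> ?; lra.
  rewrite /delta invfM mulrCA; apply: aux.
  by rewrite ler_pdivrMr// mul1r ler_nat.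
have up : \forall N \near \oo, forall i, exists Y : Omega N -> R,
    [/\ measurable_fun setT Y, forall w, 0 <= Y w,
      forall w, X i N w <= expR (N%:R * (log_potential (mu i) N + e + Y w)) &
      (\int[P N]_w (expR (l%:R * (N%:R * Y w)))%:E <= (expR (N%:R * e))%:E)%E].
  apply: filter_forall => i.
  by apply: (det_upper kappa_gt0 (H_rand i) (H_W i) (H_L i)).
have lo : \forall N \near \oo, forall i, exists G : set (Omega N),
    [/\ measurable G, (P N (~` G) <= delta%:E)%E &
      forall w, G w -> expR (N%:R * (log_potential (mu i) N - e)) <= X i N w].
  apply: filter_forall => i.
  by apply: (det_lower kappa_gt0 (H_rand i) (H_W i) (H_L i) (H_Gap i)).
near=> N.
have /andP[N0 N1] : (0 < N%:R :> R) && (0 < N)%N.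
  by near: N; exact: near_natr_gt0.
(* This absorbs the factors [1 + l exp (N e)] and 1/2 of the two bounds into
   [exp (2 N e)]; hence [e = eps / (l + 2)]. *)
have eN : l.+2%:R <= expR (N%:R * e).
  rewrite (le_trans _ (expR_ge1Dx _))// ler_wpDl// -ler_pdivrMr//.
  by near: N; exact: nbhs_infty_ger.
have upN : forall i, exists Y : Omega N -> R,
    [/\ measurable_fun setT Y, forall w, 0 <= Y w,
      forall w, X i N w <= expR (N%:R * (log_potential (mu i) N + e + Y w)) &
      (\int[P N]_w (expR (l%:R * (N%:R * Y w)))%:E <= (expR (N%:R * e))%:E)%E].
  by near: N.
have loN : forall i, exists G : set (Omega N),
    [/\ measurable G, (P N (~` G) <= delta%:E)%E &
      forall w, G w -> expR (N%:R * (log_potential (mu i) N - e)) <= X i N w].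
  by near: N.
have [Y YP] := choice upN; have [G GP] := choice loN.
pose r := fine (\int[P N]_w (\prod_(i < l) X i N w)%:E)%E.
have Ele : (\int[P N]_w (\prod_(i < l) X i N w)%:E <=
    (expR (N%:R * (S N + eps)))%:E)%E.
  apply: le_trans (integral_prod_le (X := fun i => X i N) (Y := Y) _ _ _ _ _) _.
  - exact: (fun i => mX i N).
  - by move=> i w; exact: X0.
  - by move=> i; case: (YP i).
  - by move=> i w; case: (YP i) => _ _ + _; exact.
  - by move=> i; case: (YP i).
  rewrite lee_fin; set t := expR (N%:R * e) in eN *.
  have -> : expR (N%:R * (S N + eps)) =
      expR (N%:R * (S N + l%:R * e)) * (t * t).
    by rewrite -!expRD; congr expR; rewrite -eE; ring.
  rewrite ler_wpM2l ?expR_ge0//; move: eN; rewrite -addn2 natrD.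
  have : 0 <= l%:R :> R by [].
  by move: (l%:R : R) t => L t *; nra.
have Ege : ((expR (N%:R * (S N - eps)))%:E <=
    \int[P N]_w (\prod_(i < l) X i N w)%:E)%E.
  apply: le_trans (integral_prod_ge (X := fun i => X i N) (G := G)
    (delta := delta) _ _ _ _ _); first last.
  - by move=> i w; case: (GP i) => _ _; exact.
  - by move=> i; case: (GP i).
  - by move=> i; case: (GP i).
  - by move=> i w; exact: X0.
  - exact: (fun i => mX i N).
  rewrite lee_fin (@le_trans _ _ (expR (N%:R * (S N - l%:R * e)) * 2^-1))//.
    have -> : expR (N%:R * (S N - eps)) =
        expR (N%:R * (S N - l%:R * e)) * (expR (N%:R * e) ^+ 2)^-1.
      by rewrite -expRM_natl -expRN -expRD; congr expR; rewrite -eE; ring.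
    rewrite ler_wpM2l ?expR_ge0// lef_pV2 ?posrE ?exprn_gt0 ?expR_gt0//.
    have t2 : 2 <= expR (N%:R * e) by rewrite (le_trans _ eN)// ler_nat.
    by move: (expR _) t2 => t t2; nra.
  by rewrite ler_wpM2l ?expR_ge0.
have Efin : (\int[P N]_w (\prod_(i < l) X i N w)%:E)%E \is a fin_num.
  rewrite ge0_fin_numE; first exact: le_lt_trans Ele (ltry _).
  exact: le_trans Ege.
move: Ele Ege; rewrite -(fineK Efin) -/r !lee_fin => rle rge.
have r0 : 0 < r by rewrite (lt_le_trans _ rge)// expR_gt0.
exists (N%:R^-1 * ln r - S N).
  rewrite /T unlock -/(X _ _) -(fineK Efin) -/r lne_EFin//.
  rewrite (eq_bigr (fun i => (log_potential (mu i) N)%:E)) => [|i _].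
    by rewrite sumEFin.
  exact (log_potentialE kappa_gt0 (H_W i) N1).
have lnle : ln r <= N%:R * (S N + eps).
  by rewrite -[leRHS]expRK ler_ln ?posrE ?expR_gt0.
have lnge : N%:R * (S N - eps) <= ln r.
  by rewrite -[leLHS]expRK ler_ln ?posrE ?expR_gt0.
by rewrite ler_distl [_^-1 * _]mulrC ler_pdivlMr// ler_pdivrMr// ![_ * N%:R]mulrC lnge.
Unshelve. all: by end_near.
Qed.
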